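(* Let $N\ge1$ and $q\in(0,1)$, and let $\Upsilon_N$ be the ITEM-f contraction parameter, with ITEM-f coefficients $(\alpha_k,\beta_k)_{k=1}^N$, as characterized in the context. Let $w^f=(0,1,0)$, and let $\eta_N^\star(q,w^f)$ be the unique risk coefficient for $w^f$. Then $$\eta_N^\star(q,w^f)=\Upsilon_N^{-2}.$$ Consequently, the ITEM-f upper guarantee $f(\text{output})-f_*\le\Upsilon_N^{-2}(f(x_0)-f_* )$ is the exact finite-horizon minimax risk under the initial function-value condition: for every $L>0$, $\mu=qL$, every $R_f>0$ and every $d\ge2N+1$, $$\mathscr R_N\bigl(\mathcal P^{\mu,L}_{f,R_f}(\mathbb R^d)\bigr)=\Upsilon_N^{-2}\,R_f .$$
   Context: **ITEM-f scalar data.** Write $\bar q=1-q$. $\Upsilon_N>1$ and the real coefficients $(\alpha_k,\beta_k)_{k=1}^N$ of ITEM-f satisfy the following, with $R_N:=\sqrt{\Upsilon_N^2-1}$. Terminal relations: $\alpha_N=\Upsilon_N-\sqrt q\,R_N$, $\beta_N=\sqrt{\bar q}\,R_N$. Coordinate relations for $1\le k<N$: with $\widehat d_k:=1-q\alpha_{k+1}/\Upsilon_N$ and $\widehat s_k:=\sqrt{1-\widehat d_k^{\,2}}$, $$\alpha_k=(\widehat d_k+q)\alpha_{k+1}-\widehat s_k\beta_{k+1},\qquad \beta_k=\widehat s_k(\alpha_{k+1}-\Upsilon_N)+\widehat d_k\beta_{k+1}.$$ Initial boundary relation: $\beta_1=\sqrt{\bar q/q}\,(\Upsilon_N\alpha_1-1)$.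 Order and positivity: $0<\alpha_1<\alpha_2<\dots<\alpha_N<\Upsilon_N$ and $\beta_1>0$. **Paired backward sequence.** Given $r\in(0,1)$ set $a_N=r$, $b_N=\sqrt{\bar q}\,r$, and for $k=N,\dots,2$, as long as the quantities are well defined (radicand nonnegative), set $c_k=\sqrt{(1-a_k)(1+\bar q+qa_k)}$, $d_k=\bar q+qa_k$, $a_{k-1}=d_ka_k+c_kb_k$, $b_{k-1}=-qc_ka_k+d_kb_k$. It is ordered if it is well defined through $k=1$ and $1>a_1>\dots>a_N>0$, $b_1>0$. $\mathcal O_N(q)$ is the set of $r\in(0,1)$ whose sequence is ordered. **Risk coefficient.** For a weight $w=(w_x,w_f,w_g)$ with nonnegative entries summing to $1$ and $\eta\ge0$, set $r_{\eta,w}^2=q+\eta(\bar q w_x-qw_f)$ and, when positive, let $r_{\eta,w}$ be the positive square root. $\eta$ is a risk coefficient for $w$ if $r_{\eta,w}\in\mathcal O_N(q)$ and $a_1+\eta(w_x+w_f)+\sqrt{\eta/\bar q}\,b_1=1$, where $(a_1,b_1)$ is the first pair of the backward sequence associated with $r_{\eta,w}$. When $q>0$ a risk coefficient exists and is unique; it is denoted $\eta_N^\star(q,w)$. **Problem class and risk.** $\mathcal F_{\mu,L}(\mathbb R^d)$: differentiable $\mu$-strongly convex functions on $\mathbb R^d$ with $L$-Lipschitz gradient. An instance is $(\mathcal O_f,x_0)$ with $f\in\mathcal F_{\mu,L}(\mathbb R^d)$ attaining its minimum $f_*$, $\mathcal O_f(x)=(f(x),\nabla f(x))$, and $x_0\in\mathbb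 R^d$. $\mathcal P^{\mu,L}_{f,R_f}(\mathbb R^d)$ is the set of instances with $f(x_0)-f_*\le R_f$. $\mathcal A_{N,d}$ is the set of deterministic first-order methods that may depend on the class parameters and $(N,d)$, query first at $x_0$, make at most $N$ adaptive oracle calls, and return an arbitrary function of the history of oracle answers; $\mathscr R_N(\mathcal P)=\inf_{\mathcal M\in\mathcal A_{N,d}}\sup_{(\mathcal O_f,x_0)\in\mathcal P}(f(\mathcal M(\mathcal O_f,x_0))-f_* )$. *)

(* Defs.v *)
From HB Require Import structures.
From mathcomp Require Import all_boot all_order all_algebra.
From mathcomp Require Import all_classical all_reals all_analysis.

Set Implicit Arguments.
Unset Strict Implicit.
Unset Printing Implicit Defensive.

Import Order.TTheory GRing.Theory Num.Theory.
Import numFieldNormedType.Exports.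

Local Open Scope classical_set_scope.
Local Open Scope ring_scope.

(* [alpha k] and [beta k] are meaningful for [1 <= k <= N] only.  The order
   relations force [0 < 1 - q * alpha k.+1 / U < 1], so every square root below
   has a nonnegative argument. *)
Record item_f_data (R : realType) (N : nat) (q U : R) (alpha beta : nat -> R)
    : Prop := ItemFData {
  item_f_U_gt1 : 1 < U ;
  item_f_alpha_last : alpha N = U - Num.sqrt q * Num.sqrt (U ^+ 2 - 1) ;
  item_f_beta_last : beta N = Num.sqrt (1 - q) * Num.sqrt (U ^+ 2 - 1) ;
  item_f_coord : forall k, (1 <= k < N)%N ->
    let dh := 1 - q * alpha k.+1 / U in
    let sh := Num.sqrt (1 - dh ^+ 2) in
    alpha k = (dh + q) * alpha k.+1 - sh * beta k.+1 /\
    beta k = sh * (alpha k.+1 - U) + dh * beta k.+1 ;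
  item_f_boundary : beta 1%N = Num.sqrt ((1 - q) / q) * (U * alpha 1%N - 1) ;
  item_f_alpha_gt0 : 0 < alpha 1%N ;
  item_f_alpha_lt : forall k, (1 <= k < N)%N -> alpha k < alpha k.+1 ;
  item_f_alpha_ltU : alpha N < U ;
  item_f_beta_gt0 : 0 < beta 1%N }.

Section BackwardSequence.
Context {R : realType}.
Implicit Types (q r a : R) (N k : nat) (ab : R * R).

Definition bwd_radicand q a : R := (1 - a) * (1 + (1 - q) + q * a).

Definition bwd_step q ab : R * R :=
  let c := Num.sqrt (bwd_radicand q ab.1) in
  let d := 1 - q + q * ab.1 in
  (d * ab.1 + c * ab.2, - q * c * ab.1 + d * ab.2).

(* The sequence runs from index [N] down to index [1]: the pair of index [k] is
   obtained after [N - k] steps. *)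
Definition bwd_pair N q r k : R * R :=
  iter (N - k) (bwd_step q) (r, Num.sqrt (1 - q) * r).

Definition bwd_a N q r k : R := (bwd_pair N q r k).1.
Definition bwd_b N q r k : R := (bwd_pair N q r k).2.

(* [Num.sqrt] is total, hence the explicit well-definedness condition. *)
Definition bwd_well_defined N q r : Prop :=
  forall k, (2 <= k <= N)%N -> 0 <= bwd_radicand q (bwd_a N q r k).

Definition bwd_ordered N q r : Prop :=
  [/\ bwd_well_defined N q r,
      bwd_a N q r 1 < 1,
      forall k, (1 <= k < N)%N -> bwd_a N q r k.+1 < bwd_a N q r k,
      0 < bwd_a N q r N
    & 0 < bwd_b N q r 1].

Definition ordered_set N q : set R :=
  [set r | 0 < r < 1 /\ bwd_ordered N q r].

End BackwardSequence.

Record weight (R : realType) := Weight {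
  w_x : R ;
  w_f : R ;
  w_g : R ;
  weight_ge0 : [/\ 0 <= w_x, 0 <= w_f & 0 <= w_g] ;
  weight_sum1 : w_x + w_f + w_g = 1 }.

Lemma function_weight_ge0 (R : realType) :
  [/\ 0 <= 0 :> R, 0 <= 1 :> R & 0 <= 0 :> R].
Proof. by rewrite lexx ler01. Qed.

Lemma function_weight_sum1 (R : realType) : 0 + 1 + 0 = 1 :> R.
Proof. by rewrite add0r addr0. Qed.

Definition function_weight (R : realType) : weight R :=
  Weight (function_weight_ge0 R) (function_weight_sum1 R).

Section RiskCoefficient.
Context {R : realType}.
Implicit Types (N : nat) (q eta : R) (w : weight R).

Definition weight_r2 q w eta : R := q + eta * ((1 - q) * w_x w - q * w_f w).

Definition is_risk_coefficient N q w eta : Prop :=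
  let r := Num.sqrt (weight_r2 q w eta) in
  [/\ 0 <= eta,
      0 < weight_r2 q w eta,
      ordered_set N q r
    & bwd_a N q r 1 + eta * (w_x w + w_f w)
      + Num.sqrt (eta / (1 - q)) * bwd_b N q r 1 = 1].

End RiskCoefficient.

Section ProblemClass.
Context {R : realType} {d : nat}.
Local Notation E := 'rV[R]_d.
Implicit Types (f : E -> R) (x y : E) (mu L : R).

(* The norm that the library puts on ['rV[R]_d] is the sup norm.  It gives the
   same topology, hence the same notion of differentiability, but Lipschitz and
   strong convexity constants refer to the Euclidean norm below. *)
Definition enorm x : R := Num.sqrt (\sum_i x 0 i ^+ 2).

Definition gradient f x : E := \row_i 'D_(delta_mx 0 i) f x.

Definition strongly_convex mu f : Prop :=
  forall x y (t : R), 0 <= t <= 1 ->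
    f (t *: x + (1 - t) *: y) <=
      t * f x + (1 - t) * f y - mu / 2 * t * (1 - t) * enorm (x - y) ^+ 2.

Definition smooth_strongly_convex mu L : set (E -> R) :=
  [set f | [/\ forall x, differentiable f x,
               strongly_convex mu f
             & forall x y,
                 enorm (gradient f x - gradient f y) <= L * enorm (x - y)]].

Definition attains_min f : Prop := exists xs, forall x, f xs <= f x.

Definition min_value f : R := inf (range f).

Definition answer : Type := (R * E)%type.

Definition oracle f x : answer := (f x, gradient f x).

(* An instance is given by the pair [(f, x0)]; a method accesses [f] through
   [oracle f] only. *)
Definition instance : Type := ((E -> R) * E)%type.

Definition function_value_class mu L Rf : set instance :=
  [set I | [/\ smooth_strongly_convex mu L I.1, attains_min I.1
             & I.1 I.2 - min_value I.1 <= Rf]].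

(* [next_query x0 h] is the next query point after the answers [h] (oldest
   first), or [None] if the method stops querying.  Past query points need not
   be recorded, since they are functions of [x0] and of the earlier answers. *)
Record method := Method {
  next_query : E -> seq answer -> option E ;
  output : E -> seq answer -> E }.

Fixpoint extend_history (M : method) (O : E -> answer) x0 (calls : nat)
    (h : seq answer) : seq answer :=
  if calls is n.+1 then
    if next_query M x0 h is Some y
    then extend_history M O x0 n (rcons h (O y))
    else h
  else h.

(* At most [N] calls, the first one being at [x0]. *)
Definition history (N : nat) (M : method) (O : E -> answer) x0 : seq answer :=
  if N is n.+1 then extend_history M O x0 n [:: O x0] else [::].

Definition run (N : nat) (M : method) (O : E -> answer) x0 : E :=
  output M x0 (history N M O x0).

Definition gap (N : nat) (M : method) (I : instance) : R :=
  I.1 (run N M (oracle I.1) I.2) - min_value I.1.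

(* A method may depend on the parameters of the class and on [N] and [d], since
   the infimum is taken with all of these fixed. *)
Definition minimax_risk (N : nat) (P : set instance) : \bar R :=
  ereal_inf (range (fun M : method =>
    ereal_sup [set (gap N M I)%:E | I in P])).

End ProblemClass.

Arguments function_value_class {R} d mu L Rf.

(* Main.v *)
Require Import Defs.
From HB Require Import structures.
From mathcomp Require Import all_boot all_order all_algebra.
From mathcomp Require Import all_classical all_reals all_analysis.
From mathcomp Require Import ring lra zify.

Set Implicit Arguments.
Unset Strict Implicit.
Unset Printing Implicit Defensive.

Import Order.TTheory GRing.Theory Num.Theory.
Import numFieldNormedType.Exports.

Local Open Scope classical_set_scope.
Local Open Scope ring_scope.

(* With [a_k = 1 - alpha_k / U], [b_k = sqrt q * beta_k / U] and
   [eta = U ^- 2], the ITEM-f relations become the paired backward sequence and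
   the boundary relation becomes the risk equation, so that [U ^- 2] is a risk
   coefficient.  For every risk coefficient [eta] the minimax risk is
   [eta * Rf], which also gives uniqueness.

   Upper bound, with [L = 1] and the minimizer at the origin.  For a query
   [x] with gradient [g] put [y = x - g], [p = x - y / (1 - q)] and
   [F = f x - |g|^2 / 2 - q / (2 (1 - q)) |y|^2].  The interpolation
   inequalities of the class are the subgradient inequalities
   [F_i >= F_j + <p_j, y_i - y_j>].  The method adds the ones for
   [(i, j) = (k, k + 1)] with weight [1 - a_(k+1)] and the ones for
   [(i, j) = (minimizer, k)] with the increments of these weights; its step
   sizes make the remaining quadratic form telescope exactly.

   Lower bound.  The worst function is
   [f x = |x|^2 / 2 - (1 - q) / 2 * dist (x, K)^2] for a polytope
   [K = conv {p_0, .., p_N}] that contains the minimizer [0], written in the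
   coordinates [w = x - x_0] and [t = p + q / (1 - q) x_0] in which the starting
   point is known to the method and the vertices are hidden.  The points
   [t_i = (sigma_0, .., sigma_(i-1), rho_i, 0, ..)] form a zero chain: an answer
   at a point of the span of the first [k] directions reveals only the direction
   [k].  Since the directions can be chosen orthogonal to all the earlier queries,
   no method does better than the minimum of [f] over that span. *)

(** * Euclidean geometry and gradients *)

Section DotProduct.
Context {R : realType} {n : nat}.
Implicit Types u v w : 'rV[R]_n.

Definition dot u v : R := \sum_i u 0 i * v 0 i.

Lemma dotC u v : dot u v = dot v u.
Proof. by apply: eq_bigr => i _; rewrite mulrC. Qed.

Lemma dotDl u v w : dot (u + v) w = dot u w + dot v w.
Proof. by rewrite -big_split; apply: eq_bigr => i _; rewrite mxE mulrDl. Qed.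

Lemma dotZl (a : R) u v : dot (a *: u) v = a * dot u v.
Proof. by rewrite mulr_sumr; apply: eq_bigr => i _; rewrite mxE mulrA. Qed.

Lemma dotDr u v w : dot w (u + v) = dot w u + dot w v.
Proof. by rewrite dotC dotDl !(dotC w). Qed.

Lemma dotZr (a : R) u v : dot u (a *: v) = a * dot u v.
Proof. by rewrite dotC dotZl dotC. Qed.

Lemma dotNl u v : dot (- u) v = - dot u v.
Proof. by rewrite -scaleN1r dotZl mulN1r. Qed.

Lemma dotNr u v : dot u (- v) = - dot u v.
Proof. by rewrite dotC dotNl dotC. Qed.

Lemma dot0l u : dot 0 u = 0.
Proof. by rewrite -(scale0r u) dotZl mul0r. Qed.

Lemma dot0r u : dot u 0 = 0.
Proof. by rewrite dotC dot0l. Qed.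

Definition dotE := (dotDl, dotDr, dotNl, dotNr, dotZl, dotZr, dot0l, dot0r).

Lemma dot_sumr (I : Type) (s : seq I) (P : pred I) (F : I -> 'rV[R]_n) u :
  dot u (\sum_(i <- s | P i) F i) = \sum_(i <- s | P i) dot u (F i).
Proof. by elim/big_rec2: _ => [|i y x _ <-]; rewrite ?dot0r ?dotDr. Qed.

Lemma dot_suml (I : Type) (s : seq I) (P : pred I) (F : I -> 'rV[R]_n) u :
  dot (\sum_(i <- s | P i) F i) u = \sum_(i <- s | P i) dot (F i) u.
Proof. by rewrite dotC dot_sumr; apply: eq_bigr => i _; rewrite dotC. Qed.

Lemma dot_delta u i : dot u (delta_mx 0 i) = u 0 i.
Proof.
rewrite /dot (bigD1 i) //= mxE !eqxx mulr1 big1 ?addr0 // => j ji.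
by rewrite mxE (negbTE ji) andbF mulr0.
Qed.

Lemma dot_ge0 u : 0 <= dot u u.
Proof. by apply: sumr_ge0 => i _; rewrite -expr2 sqr_ge0. Qed.

Lemma dot_eq0 u : dot u u = 0 -> u = 0.
Proof.
move=> /eqP; rewrite psumr_eq0 => [/allP u0|i _]; last by rewrite -expr2 sqr_ge0.
apply/rowP => i; rewrite mxE; apply/eqP.
by have := u0 i (mem_index_enum _); rewrite /= mulf_eq0 orbb.
Qed.

Lemma enorm_sqr u : enorm u ^+ 2 = dot u u.
Proof.
rewrite /enorm sqr_sqrtr; first by apply: eq_bigr => i _; rewrite expr2.
by apply: sumr_ge0 => i _; rewrite sqr_ge0.
Qed.

Lemma enorm_ge0 u : 0 <= enorm u.
Proof. exact: sqrtr_ge0. Qed.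

Lemma cauchy_schwarz u v : dot u v <= enorm u * enorm v.
Proof.
have [->|u0] := eqVneq u 0; first by rewrite dot0l mulr_ge0 ?enorm_ge0.
have u_gt0 : 0 < dot u u.
  by rewrite lt0r dot_ge0 andbT; apply: contra u0 => /eqP/dot_eq0 ->.
apply: le_trans (ler_norm _) _.
rewrite -(@ler_pXn2r _ 2) ?nnegrE ?normr_ge0 ?mulr_ge0 ?enorm_ge0 //.
rewrite exprMn !enorm_sqr real_normK ?num_real //.
have := dot_ge0 (dot u u *: v - dot u v *: u).
rewrite !dotE (dotC v u) => H.
have : 0 <= dot u u * (dot u u * dot v v - dot u v ^+ 2) by nra.
by rewrite pmulr_rge0 // subr_ge0.
Qed.

Lemma dot_le_norm u : dot u u <= n%:R * `|u| ^+ 2.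
Proof.
apply: le_trans (_ : \sum_(i < n) `|u| ^+ 2 <= _); last first.
  by rewrite sumr_const card_ord mulr_natl.
apply: ler_sum => i _; rewrite -expr2 -[_ ^+ 2]real_normK ?num_real //.
rewrite ler_pXn2r ?nnegrE ?normr_ge0 //.
rewrite [leRHS]mx_normrE.
exact: (le_bigmax _ (fun i : 'I_1 * 'I_n => `|u i.1 i.2|) (0, i)).
Qed.

End DotProduct.

Section Differential.
Context {R : realType} {d : nat}.
Local Notation E := 'rV[R]_d.
Implicit Types (f : E -> R) (x y v : E).

Lemma dot_is_linear v : linear (dot v : E -> R^o).
Proof. by move=> a x y; rewrite dotDr dotZr. Qed.

HB.instance Definition _ v :=
  GRing.isLinear.Build R E R^o *:%R (dot v) (dot_is_linear v).

Lemma dot_continuous v : continuous (dot v : E -> R).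
Proof.
have addc : continuous (fun z : R * R => z.1 + z.2) by exact: add_continuous.
have Fc i : xpredT i -> continuous (fun x : E => v 0 i * x 0 i).
  move=> _ x; apply: (@continuousM _ _ (fun=> v 0 i) (fun y : E => y 0 i)).
    exact: cst_continuous.
  exact: coord_continuous.
exact: (continuous_big addc Fc).
Qed.

(** A remainder quadratic in the Euclidean norm is [o(h)] for the sup norm of the library, by
    [dot_le_norm]; uniqueness of the differential then identifies [v]. *)
Lemma gradient_of_expansion f x v C :
  (forall h, `|f (h + x) - f x - dot v h| <= C * dot h h) ->
  differentiable f x /\ gradient f x = v.
Proof.
move=> fE.
have C1 : 0 < `|C| * d%:R + 1 by rewrite ltr_wpDl // mulr_ge0.
have fo : (f : E -> R^o) \o shift x = cst (f x) + (dot v : E -> R^o) +o_ (0 : E) id.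
  apply/eqaddoP => e e0; near=> h.
  have -> : (f \o shift x - (cst (f x) + dot v)) h = f (h + x) - f x - dot v h.
    by rewrite /= opprD addrA.
  apply: le_trans (fE h) _.
  have h_le : `|h| <= e / (`|C| * d%:R + 1).
    near: h; have e'0 : 0 < e / (`|C| * d%:R + 1) by rewrite divr_gt0.
    apply/nbhs_ballP; exists (e / (`|C| * d%:R + 1)) => //= h.
    by rewrite -ball_normE /= sub0r normrN => /ltW.
  apply: le_trans (_ : `|C| * (d%:R * `|h| ^+ 2) <= _).
    apply: le_trans (_ : `|C| * dot h h <= _).
      by rewrite ler_wpM2r ?dot_ge0 ?ler_norm.
    by rewrite ler_wpM2l // dot_le_norm.
  move: h_le; rewrite ler_pdivlMr // => h_le.
  have h_le2 := ler_wpM2r (normr_ge0 h) h_le.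
  have h2 := sqr_ge0 `|h|.
  by rewrite /=; lra.
have dE := diff_unique (@dot_continuous v) fo.
have df : differentiable f x.
  by apply/diff_locallyP; rewrite dE; split=> //; exact: dot_continuous.
split=> //; apply/rowP => i; rewrite mxE deriveE // dE.
by rewrite /= dot_delta.
Unshelve. all: by end_near. Qed.

Lemma derive_gradient f x v : differentiable f x ->
  'D_v f x = dot (gradient f x) v.
Proof.
move=> df; rewrite deriveE // {1}[v]row_sum_delta linear_sum.
by apply: eq_bigr => i _; rewrite linearZ /= mxE deriveE // mulrC.
Qed.

Lemma is_derive_line f x v (t : R) : (forall y, differentiable f y) ->
  is_derive t 1 (fun s : R => f (x + s *: v))
    (dot (gradient f (x + t *: v)) v).
Proof.
move=> df; rewrite -derive_gradient //.
have E1 : (fun h : R => h^-1 *: (((fun s : R => f (x + s *: v)) \o shift t)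
    (h *: (1 : R)) - f (x + t *: v))) =
  (fun h : R => h^-1 *: ((f \o shift (x + t *: v)) (h *: v)
    - f (x + t *: v))).
  apply/funext => h /=; congr (_ *: (f _ - _)).
  by rewrite [h *: 1]mulr1 scalerDl addrCA.
have fv : derivable f (x + t *: v) v by exact: diff_derivable.
by split; [rewrite /derivable E1 | rewrite /derive E1].
Qed.

End Differential.

(** * Interpolation inequalities *)

Section SmoothStronglyConvex.
Context {R : realType} {d : nat}.
Local Notation E := 'rV[R]_d.
Implicit Types (f : E -> R) (x y z v : E) (mu L : R).

Lemma min_value_eq f x : (forall y, f x <= f y) -> min_value f = f x.
Proof.
move=> fmin; apply/eqP; rewrite eq_le /min_value; apply/andP; split.
  by apply: ge_inf; [exists (f x) => _ [y _ <-] | exists x].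
by apply: lb_le_inf; [exists (f x), x | move=> _ [y _ <-]].
Qed.

Lemma quadratic_bound f L x v : 0 <= L ->
  (forall y, differentiable f y) ->
  (forall y z, enorm (gradient f y - gradient f z) <= L * enorm (y - z)) ->
  `|f (x + v) - f x - dot (gradient f x) v| <= L / 2 * dot v v.
Proof.
move=> L0 df lip.
have side (s : R) : `|s| = 1 ->
    s * (f (x + v) - f x - dot (gradient f x) v) <= L / 2 * dot v v.
  move=> s1.
  (* [psi 1 - psi 0] is the signed remainder minus the claimed bound. By the Lipschitz condition
     [dpsi] is nonpositive on the interval, so the mean value theorem replaces an integration. *)
  pose psi t := s * (f (x + t *: v) - t * dot (gradient f x) v)
    - L / 2 * dot v v * t ^+ 2.
  pose dpsi t := s * (dot (gradient f (x + t *: v)) v - dot (gradient f x) v)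
    - L * dot v v * t.
  have psiD (t : R) : is_derive t 1 psi (dpsi t).
    have D := is_derive_line x v t df.
    rewrite /psi.
    apply: is_derive_eq; rewrite /dpsi /=.
    by rewrite /GRing.scale /=; field.
  have psi01 := @MVT R psi dpsi 0 1 ltr01 (fun t _ => psiD t).
  have [|c /[!in_itv]/= /andP[c0 c1]] := psi01.
    apply: continuous_subspaceT => t.
    apply: differentiable_continuous; apply/derivable1_diffP.
    exact: (@ex_derive _ _ _ _ _ _ _ (psiD t)).
  rewrite /psi scale1r scale0r addr0 subr0 mulr1 => E1.
  suff : dpsi c <= 0 by move: E1; lra.
  rewrite /dpsi -dotNl -dotDl subr_le0.
  apply: le_trans (ler_norm _) _; rewrite normrM s1 mul1r.
  have : `|dot (gradient f (x + c *: v) - gradient f x) v|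
      <= enorm (gradient f (x + c *: v) - gradient f x) * enorm v.
    rewrite ler_norml cauchy_schwarz andbT.
    rewrite lerNl -dotNr; apply: le_trans (cauchy_schwarz _ _) _.
    suff -> : enorm (- v) = enorm v by [].
    by rewrite /enorm; congr Num.sqrt; apply: eq_bigr => i _; rewrite mxE sqrrN.
  move/le_trans; apply.
  have -> : L * dot v v * c = (L * (c * enorm v)) * enorm v.
    by rewrite -enorm_sqr; ring.
  rewrite ler_wpM2r ?enorm_ge0 //; apply: le_trans (lip _ _) _.
  rewrite ler_wpM2l // addrC addKr.
  suff -> : enorm (c *: v) = c * enorm v by [].
  apply/eqP; rewrite -(@eqrXn2 _ 2) ?mulr_ge0 ?enorm_ge0 ?(ltW c0) //.
  by rewrite exprMn !enorm_sqr !dotE; apply/eqP; ring.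
rewrite ler_norml; apply/andP; split.
  rewrite lerNl -mulN1r; apply: side; by rewrite normrN normr1.
by rewrite -[leLHS]mul1r; apply: side; rewrite normr1.
Qed.

(** Letting [t] tend to [0]: the form in which first-order conditions are extracted from
    inequalities along a segment. *)
Lemma le_of_linear_slack (a b C : R) :
  (forall t, 0 < t <= 1 -> a <= b + t * C) -> a <= b.
Proof.
move=> H; apply/ler_addgt0Pr => e e0.
have C1 : 0 < `|C| + 1 by rewrite ltr_wpDl.
pose t := Num.min 1 (e / (`|C| + 1)).
have t0 : 0 < t by rewrite lt_min ltr01 divr_gt0.
have t1 : t <= 1 by rewrite ge_min lexx.
apply: le_trans (H t _) _; first by rewrite t0.
rewrite lerD2l; apply: le_trans (_ : t * (`|C| + 1) <= _).
  by rewrite ler_wpM2l ?(ltW t0) // (le_trans (ler_norm C)) // lerDl.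
by rewrite -ler_pdivlMr // ge_min lexx orbT.
Qed.

(** Strong convexity bounds [f (x + t *: v)] from above and [quadratic_bound] bounds it from below;
    after division by [t] the error is linear in [t]. *)
Lemma strong_convexity_lower_bound f mu L x v :
  0 <= L -> smooth_strongly_convex mu L f ->
  f x + dot (gradient f x) v + mu / 2 * dot v v <= f (x + v).
Proof.
move=> L0 [df sc lip].
apply: (@le_of_linear_slack _ _ ((mu + L) / 2 * dot v v)) => t /andP[t0 t1].
have := sc (x + v) x t; rewrite (ltW t0) t1 => /(_ isT).
have -> : t *: (x + v) + (1 - t) *: x = x + t *: v.
  by apply/rowP => i; rewrite !mxE; ring.
rewrite (_ : x + v - x = v) ?[x + v]addrC ?addrK // enorm_sqr [v + x]addrC => Hsc.
have := quadratic_bound x (t *: v) L0 df lip.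
rewrite ler_norml !dotE => /andP[Hq _].
rewrite -(ler_pM2l t0); move: Hsc Hq; lra.
Qed.

Variables (q L : R) (f : E -> R) (c : E).
Hypotheses (q1 : q < 1) (L0 : 0 < L).
Hypothesis fP : smooth_strongly_convex (q * L) L f.

Definition scaled_grad x : E := L^-1 *: gradient f x.

Lemma scaled_lower_bound x z :
  f x / L + dot (scaled_grad x) (z - x) + q / 2 * dot (z - x) (z - x)
    <= f z / L.
Proof.
have := strong_convexity_lower_bound x (z - x) (ltW L0) fP.
rewrite [x + (z - x)]addrC subrK -(ler_pM2r (_ : 0 < L^-1)) ?invr_gt0 //; apply: le_trans.
rewrite /scaled_grad dotZl le_eqVlt; apply/orP; left; apply/eqP.
by field; rewrite gt_eqF.
Qed.

Lemma scaled_upper_bound x z :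
  f z / L <=
    f x / L + dot (scaled_grad x) (z - x) + 2^-1 * dot (z - x) (z - x).
Proof.
have [df _ lip] := fP.
have := quadratic_bound x (z - x) (ltW L0) df lip.
rewrite ler_norml [x + (z - x)]addrC subrK => /andP[_ H].
rewrite -(ler_pM2r L0) divfK ?gt_eqF //; apply: le_trans (_ : f x +
  dot (gradient f x) (z - x) + L / 2 * dot (z - x) (z - x) <= _).
  by move: H; lra.
rewrite /scaled_grad dotZl le_eqVlt; apply/orP; left; apply/eqP.
by field; rewrite gt_eqF.
Qed.

(** The point [c] serves as origin of coordinates; [itemf_guarantee] takes a minimizer for it. *)
Definition gd_point x : E := x - c - scaled_grad x.

Definition reduced_value x : R :=
  f x / L - dot (scaled_grad x) (scaled_grad x) / 2
  - q / (2 * (1 - q)) * dot (gd_point x) (gd_point x).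

Definition dual_point x : E := (x - c) - (1 - q)^-1 *: gd_point x.

Lemma reduced_subgradient x z :
  reduced_value z + dot (dual_point z) (gd_point x - gd_point z)
    <= reduced_value x.
Proof.
(* The point where the quadratic minorant built at [z] exceeds the majorant built at [x] the most;
   comparing the two there gives the sharpest inequality. *)
pose w := x - dual_point x + dual_point z.
have := le_trans (scaled_lower_bound z w) (scaled_upper_bound x w).
rewrite -subr_ge0 => H; rewrite -subr_ge0; apply: le_trans H _.
have wx : w - x = dual_point z - dual_point x.
  rewrite /w; move: (dual_point x) (dual_point z) => p p'.
  by apply/rowP => i; rewrite !mxE; ring.
have wz : w - z = (x - c) - (z - c) + dual_point z - dual_point x.
  rewrite /w; move: (dual_point x) (dual_point z) => p p'.
  by apply/rowP => i; rewrite !mxE; ring.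
rewrite wx wz /reduced_value /dual_point /gd_point.
have q' : 1 - q != 0 by rewrite subr_eq0 gt_eqF.
move: (x - c) (z - c) (scaled_grad x) (scaled_grad z) (f x / L) (f z / L).
move=> X Z G H a b; clear -q'.
rewrite !dotE (dotC Z X) (dotC G X) (dotC H X) (dotC G Z) (dotC H Z) (dotC H G).
rewrite le_eqVlt; apply/orP; left; apply/eqP.
by field.
Qed.

End SmoothStronglyConvex.

(** * Risk coefficients *)

(** The interface shared by the upper and the lower bound. The root [c k] enters through its square,
    and [rs_circle] is an invariant of the backward recursion. *)
Record risk_scheme (R : realType) (N : nat) (q eta : R) (a b c : nat -> R)
    : Prop := RiskScheme {
  rs_N : (1 <= N)%N ;
  rs_q_gt0 : 0 < q ;
  rs_q_lt1 : q < 1 ;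
  rs_eta_gt0 : 0 < eta ;
  rs_eta_lt1 : eta < 1 ;
  rs_a_gt0 : forall k, (1 <= k <= N)%N -> 0 < a k ;
  rs_a_lt1 : forall k, (1 <= k <= N)%N -> a k < 1 ;
  rs_a_dec : forall k, (1 <= k < N)%N -> a k.+1 < a k ;
  rs_b_gt0 : forall k, (1 <= k <= N)%N -> 0 < b k ;
  rs_c_gt0 : forall k, (1 <= k <= N)%N -> 0 < c k ;
  rs_c_sqr : forall k, (1 <= k <= N)%N ->
    c k ^+ 2 = (1 - a k) * (1 + (1 - q) + q * a k) ;
  rs_a_step : forall k, (1 <= k < N)%N ->
    a k = (1 - q + q * a k.+1) * a k.+1 + c k.+1 * b k.+1 ;
  rs_b_step : forall k, (1 <= k < N)%N ->
    b k = - q * c k.+1 * a k.+1 + (1 - q + q * a k.+1) * b k.+1 ;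
  rs_circle : forall k, (1 <= k <= N)%N -> a k ^+ 2 + b k ^+ 2 / q = 1 - eta ;
  rs_b_last : b N = Num.sqrt (1 - q) * a N ;
  rs_boundary : a 1%N + eta + Num.sqrt (eta / (1 - q)) * b 1%N = 1 }.

Section FromRiskCoefficient.
Context {R : realType}.
Variables (N : nat) (q eta : R).
Hypotheses (N1 : (1 <= N)%N) (q01 : 0 < q < 1).

Let r := Num.sqrt (weight_r2 q (function_weight R) eta).
Let a := bwd_a N q r.
Let b := bwd_b N q r.
Let c k := Num.sqrt (bwd_radicand q (a k)).

Lemma bwd_step_eq k : (k < N)%N ->
  a k = (1 - q + q * a k.+1) * a k.+1 + c k.+1 * b k.+1 /\
  b k = - q * c k.+1 * a k.+1 + (1 - q + q * a k.+1) * b k.+1.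
Proof.
by move=> kN; rewrite /a /b /c /bwd_a /bwd_b /bwd_pair -(subnSK kN).
Qed.

Lemma backward_ind (P : nat -> Prop) :
  P N -> (forall k, (1 <= k < N)%N -> P k.+1 -> P k) ->
  forall k, (1 <= k <= N)%N -> P k.
Proof.
move=> PN IH k /andP[k1 kN]; rewrite -(subKn kN).
have : (N - k < N)%N by rewrite -subn_gt0 subKn.
elim: (N - k)%N => [|m IHm] mN; first by rewrite subn0.
have IHm' := IHm (ltnW mN).
apply: IH; last by rewrite subnSK ?(ltnW mN).
by rewrite subn_gt0 mN -subSn ?(ltnW mN) // subSS leq_subr.
Qed.

Lemma risk_coefficient_scheme :
  is_risk_coefficient N q (function_weight R) eta -> risk_scheme N q eta a b c.
Proof.
case/andP: q01 => q0 q1 [eta0 r2_gt0].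
rewrite -/r => -[/andP[r0 r1] [wd a1 adec aN0 b10]].
rewrite /= add0r mulr1 -/a -/b => bnd.
have r2E : r ^+ 2 = q * (1 - eta).
  by rewrite /r sqr_sqrtr ?ltW // /weight_r2 /=; ring.
have aN : a N = r by rewrite /a /bwd_a /bwd_pair subnn.
have bN : b N = Num.sqrt (1 - q) * r by rewrite /b /bwd_b /bwd_pair subnn.
have eta_lt1 : eta < 1.
  by have : 0 < q * (1 - eta) by [rewrite -r2E exprn_gt0|]; rewrite pmulr_rgt0 ?subr_gt0.
have a_mono k : (1 <= k <= N)%N -> a N <= a k.
  move: k; apply: backward_ind => // k kN /le_trans; apply.
  exact/ltW/adec.
have a_gt0 k : (1 <= k <= N)%N -> 0 < a k.
  by move=> kN; apply: lt_le_trans (a_mono _ kN); rewrite aN.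
have a_lt1 k : (1 <= k <= N)%N -> a k < 1.
  move=> /andP[]; elim: k => // -[|k] IHk // _ kN; apply: lt_trans (IHk isT _).
    by apply: adec; rewrite kN.
  exact: ltnW.
have rad_gt0 k : (1 <= k <= N)%N -> 0 < bwd_radicand q (a k).
  move=> kN; rewrite /bwd_radicand mulr_gt0 ?subr_gt0 ?a_lt1 //.
  by rewrite ltr_pwDr ?mulr_gt0 ?a_gt0 // addr_ge0 // subr_ge0 ltW.
have c_gt0 k : (1 <= k <= N)%N -> 0 < c k.
  by move=> kN; rewrite /c sqrtr_gt0 rad_gt0.
have c_sqr k : (1 <= k <= N)%N ->
    c k ^+ 2 = (1 - a k) * (1 + (1 - q) + q * a k).
  by move=> kN; rewrite /c sqr_sqrtr ?ltW ?rad_gt0.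
have d_gt0 k : (1 <= k <= N)%N -> 0 < 1 - q + q * a k.
  by move=> kN; rewrite ltr_wpDl ?mulr_gt0 ?a_gt0 // subr_ge0 ltW.
(* Positivity climbs from [b 1], because [b k] is at most a positive multiple of [b k.+1]. *)
have b_gt0 k : (1 <= k <= N)%N -> 0 < b k.
  move=> /andP[]; elim: k => // -[|k] IHk // _ kN.
  have k1N : (1 <= k.+2 <= N)%N by rewrite kN.
  have := IHk isT (ltnW kN); have [_ ->] := bwd_step_eq kN => bk.
  rewrite -(pmulr_rgt0 _ (d_gt0 _ k1N)); apply: lt_le_trans bk _.
  rewrite gerDr !mulNr oppr_le0 !mulr_ge0 ?ltW ?c_gt0 ?a_gt0 //.
(* In the coordinates [a] and [b / sqrt q] a backward step is a rotation, since
   [d ^+ 2 + q * c ^+ 2 = 1]. The radius is fixed at index [N] by [r ^+ 2 = q * (1 - eta)]. *)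
have circle k : (1 <= k <= N)%N -> a k ^+ 2 + b k ^+ 2 / q = 1 - eta.
  move: k; apply: backward_ind.
    rewrite aN bN exprMn (@sqr_sqrtr _ (1 - q)) ?subr_ge0 ?ltW // r2E.
    by field; rewrite gt_eqF.
  move=> k /andP[k1 kN]; have k1N : (1 <= k.+1 <= N)%N by rewrite kN.
  have [-> ->] := bwd_step_eq kN; move=> <-.
  have := c_sqr _ k1N; move: (a k.+1) (b k.+1) (c k.+1) => A B C C2.
  transitivity (((1 - q + q * A) ^+ 2 + q * C ^+ 2) * (A ^+ 2 + B ^+ 2 / q)).
    by field; rewrite gt_eqF.
  by rewrite C2; field; rewrite gt_eqF.
split=> //.
- rewrite lt0r eta0 andbT; apply/eqP => eta_eq0.
  move: bnd a1; rewrite eta_eq0 mul0r sqrtr0 mul0r !addr0 -/a => ->.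
  by rewrite ltxx.
- by move=> k /andP[_ kN]; have [] := bwd_step_eq kN.
- by move=> k /andP[_ kN]; have [] := bwd_step_eq kN.
- by rewrite aN.
Qed.

End FromRiskCoefficient.

(** * Quadratic identities behind the telescoping potential *)

Section UpperBoundAlgebra.
Context {R : realType} {d : nat}.
Local Notation E := 'rV[R]_d.

(** Used with [l = 1 - a 1] and [kap = sqrt (eta * (1 - q))]. The choice of [h] makes
    [V = (kap + b) *: y - kap *: X]; what is left is a multiple of [dot y y] that vanishes by the
    circle relation. *)
Lemma potential_init_identity (q eta l b s kap : R) (X y : E) :
  q != 1 -> s != 0 -> kap ^+ 2 = (1 - q) * eta -> kap * b = (1 - q) * (l - eta) ->
  b ^+ 2 = q * (1 - eta - (1 - l) ^+ 2) ->
  let h := (s + kap) / s in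
  let V := s *: ((1 - h) *: X + h *: y) - (s - b) *: y in
  eta * (dot (X - y) (X - y) / 2 + q / (2 * (1 - q)) * dot y y)
    - (l - eta) * dot (X - (1 - q)^-1 *: y) y
  = (dot V V + q * l ^+ 2 * dot y y) / (2 * (1 - q)).
Proof.
move=> q1 s0 kap2 kapb b2 h V.
have q1' : 1 - q != 0 by rewrite subr_eq0 eq_sym.
have VE : V = (kap + b) *: y - kap *: X.
  by rewrite /V /h; apply/rowP => i; rewrite !mxE; field.
rewrite VE !dotE (dotC y X).
have etaE : eta = kap ^+ 2 / (1 - q) by rewrite kap2 mulrC mulKf.
have lE : l = eta + kap * b / (1 - q) by rewrite kapb; field.
have b2' : b ^+ 2 - q * (1 - eta - (1 - l) ^+ 2) = 0 by rewrite b2 subrr.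
apply/eqP; rewrite -subr_eq0; apply/eqP.
transitivity ((q * (1 - eta - (1 - l) ^+ 2) - b ^+ 2) / (2 * (1 - q)) * dot y y).
  rewrite lE etaE; field; exact: q1'.
by rewrite -opprB b2' oppr0 !mul0r.
Qed.

Lemma potential_step_identity (q l0 l1 b0 s0 b s c : R) (X y y' : E) :
  q != 1 -> s != 0 -> c != 0 -> l1 != 0 ->
  c ^+ 2 = l1 * (2 - q * l1) ->
  s0 = (1 - q) * l1 / c -> s0 - b0 = l0 * (1 - q * l1) / c ->
  let X1 := ((c + s - b) / s) *: y - ((1 - q) * l1 / (s * c)) *: X
            - (l0 / (s * c)) *: y' in
  let V1 := s *: X1 - (s - b) *: y in
  let V0 := s0 *: X - (s0 - b0) *: y' in
  let p := X - (1 - q)^-1 *: y in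
  (dot V1 V1 + q * l1 ^+ 2 * dot y y) / (2 * (1 - q)) + l1 * dot p y
    - l0 * dot p y'
  = (dot V0 V0 + q * l0 ^+ 2 * dot y' y') / (2 * (1 - q)).
Proof.
move=> q1 s_0 c0 l10 c2 s0E sb0 X1 V1 V0 p.
have q1' : 1 - q != 0 by rewrite subr_eq0 eq_sym.
have V1E : V1 = c *: y - ((1 - q) * l1 / c) *: X - (l0 / c) *: y'.
  by rewrite /V1 /X1; apply/rowP => i; rewrite !mxE; field; rewrite c0.
rewrite V1E /V0 /p sb0 s0E !dotE (dotC y X) (dotC y' X) (dotC y y').
(* The relation for [c ^+ 2] is linear in [q]; eliminating [q] leaves a rational identity without
   side conditions other than nonzero denominators. *)
have qE : q = (2 * l1 - c ^+ 2) / l1 ^+ 2 by rewrite c2; field.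
move: q1'; rewrite qE => q1'.
have q2' : l1 ^+ 2 - (2 * l1 - c ^+ 2) != 0.
  apply: contra q1' => /eqP H; apply/eqP.
  have -> : 2 * l1 - c ^+ 2 = l1 ^+ 2 by move: H; lra.
  by rewrite divff ?subrr // expf_neq0.
by field; rewrite c0 l10 q2'.
Qed.

End UpperBoundAlgebra.

(** * The optimal method *)

Section OptimalMethod.
Context {R : realType} {d : nat}.
Local Notation E := 'rV[R]_d.
Variables (N : nat) (q eta L : R) (a b c : nat -> R).
Hypotheses (S : risk_scheme N q eta a b c) (L0 : 0 < L).

Ltac lra_goal := clear -R d N q eta L a b c S L0; lra.

(* The potential after [k] answers involves the square of
   [itemf_scale k *: x - (itemf_scale k - b k) *: y], with [x] the next query and
   [y] the last gradient step. *)
Definition itemf_scale k : R :=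
  if k == N then Num.sqrt (1 - q) else (1 - q) * (1 - a k.+1) / c k.+1.

Local Notation s := itemf_scale.

(* The step sizes cancel all the terms containing the last [y] in the quadratic
   form left over by the multipliers, see [potential_step_identity]; their
   coefficients add up to [1], so that no knowledge of the minimizer is needed. *)
Definition itemf_init_step (x y : E) : E :=
  let h := (s 1 + Num.sqrt (eta * (1 - q))) / s 1 in
  (1 - h) *: x + h *: y.

Definition itemf_next_step k (x y y' : E) : E :=
  ((c k.+1 + s k.+1 - b k.+1) / s k.+1) *: y
  - ((1 - q) * (1 - a k.+1) / (s k.+1 * c k.+1)) *: x
  - ((1 - a k) / (s k.+1 * c k.+1)) *: y'.

(** The state holds the number of answers, the next query and the last gradient step; the latter
    starts as the placeholder [0], as no gradient step precedes the first answer. *)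
Definition itemf_step (st : nat * E * E) (ans : @answer R d) : nat * E * E :=
  let: (k, x, y') := st in
  let y := x - L^-1 *: ans.2 in
  (k.+1, if k == 0%N then itemf_init_step x y else itemf_next_step k x y y', y).

Definition itemf_fold (x0 : E) (h : seq (@answer R d)) : E :=
  (foldl itemf_step (0%N, x0, 0) h).1.2.

(** The output is the point that would be queried next. *)
Definition itemf_method : @method R d :=
  Method (fun x0 h => Some (itemf_fold x0 h)) itemf_fold.

Fixpoint itemf_state (f : E -> R) (x0 : E) k : nat * E * E :=
  if k is n.+1 then
    let st := itemf_state f x0 n in itemf_step st (oracle f st.1.2)
  else (0%N, x0, 0).

Lemma itemf_run f x0 :
  run N itemf_method (oracle f) x0 = (itemf_state f x0 N).1.2.
Proof.
pose ans k := oracle f (itemf_state f x0 k).1.2.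
have foldE k : foldl itemf_step (0%N, x0, 0) (mkseq ans k) = itemf_state f x0 k.
  by elim: k => // k IHk; rewrite mkseqS foldl_rcons IHk.
have extE n m : extend_history itemf_method (oracle f) x0 n (mkseq ans m)
    = mkseq ans (m + n).
  elim: n m => [|n IHn] m; first by rewrite addn0.
  by rewrite /= /itemf_fold foldE -/(ans m) -mkseqS IHn addSnnS.
rewrite /run /history; case: N (rs_N S) => // n _.
by rewrite -[[:: _]]/(mkseq ans 1) extE add1n /= /itemf_fold foldE.
Qed.

Lemma itemf_state_idx f x0 k : (itemf_state f x0 k).1.1 = k.
Proof.
elim: k => //= k; case: (itemf_state f x0 k) => -[i x] y /= ->.
by [].
Qed.

Lemma itemf_scale_gt0 k : (1 <= k <= N)%N -> 0 < s k.
Proof.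
case: S => N1 q0 q1 _ _ _ a1 _ _ c0 _ _ _ _ _ _ /andP[k1].
rewrite /s leq_eqVlt; case: eqP => [_ _|_ /= kN]; first by rewrite sqrtr_gt0 subr_gt0.
by rewrite divr_gt0 ?c0 // mulr_gt0 ?subr_gt0 ?a1.
Qed.

Lemma itemf_scale_sub k : (1 <= k < N)%N ->
  s k - b k = (1 - a k) * (1 - q * (1 - a k.+1)) / c k.+1.
Proof.
move=> kN; have /andP[k1 ltkN] := kN.
have k1N : (1 <= k.+1 <= N)%N by rewrite ltkN.
have c0 := rs_c_gt0 S k1N; have c2 := rs_c_sqr S k1N.
rewrite /s ltn_eqF // (rs_b_step S kN) (rs_a_step S kN).
move: c0 c2; move: (a k.+1) (b k.+1) (c k.+1) => A B C C0 C2.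
apply/eqP; rewrite -subr_eq0; apply/eqP.
transitivity (q * A * (C ^+ 2 - (1 - A) * (1 + (1 - q) + q * A)) / C); last first.
  by rewrite C2 subrr mulr0 mul0r.
field; rewrite gt_eqF //.
Qed.

Lemma affine_comb (u v w : R) (x y y' z : E) : u - v - w = 1 ->
  u *: y - v *: x - w *: y' - z = u *: (y - z) - v *: (x - z) - w *: (y' - z).
Proof.
move=> uvw; have -> : u = 1 + v + w by rewrite -uvw; ring.
by apply/rowP => i; rewrite !mxE; ring.
Qed.

Lemma itemf_next_step_affine k x y y' z : (1 <= k < N)%N ->
  itemf_next_step k x y y' - z = itemf_next_step k (x - z) (y - z) (y' - z).
Proof.
move=> kN; have /andP[k1 ltkN] := kN.
have k1N : (1 <= k.+1 <= N)%N by rewrite ltkN.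
have c0 := rs_c_gt0 S k1N; have c2 := rs_c_sqr S k1N.
have s0 := itemf_scale_gt0 k1N.
suff sum1 : (c k.+1 + s k.+1 - b k.+1) / s k.+1
  - (1 - q) * (1 - a k.+1) / (s k.+1 * c k.+1) - (1 - a k) / (s k.+1 * c k.+1) = 1.
  exact: affine_comb.
rewrite (rs_a_step S kN); move: (s k.+1) s0 c0 c2.
move: (a k.+1) (b k.+1) (c k.+1) => A B C T T0 C0 C2.
apply/eqP; rewrite -subr_eq0; apply/eqP.
transitivity ((C ^+ 2 - (1 - A) * (1 + (1 - q) + q * A)) / (T * C)); last first.
  by rewrite C2 subrr mul0r.
by field; rewrite !gt_eqF.
Qed.

(** The telescoping argument for abstract sequences centered at the minimizer. The first hypothesis
    collects the inequalities against the minimizer, the second those between consecutive iterates;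
    [pot] starts below [eta * value 0], decreases, and ends above [value N]. *)
Lemma itemf_potential (F : nat -> R) (X y : nat -> E) :
  let p k := X k - (1 - q)^-1 *: y k in
  let value k := F k + dot (X k - y k) (X k - y k) / 2
                 + q / (2 * (1 - q)) * dot (y k) (y k) in
  (forall k, F k <= dot (p k) (y k)) ->
  (forall k, F k.+1 + dot (p k.+1) (y k) - dot (p k.+1) (y k.+1) <= F k) ->
  X 1%N = itemf_init_step (X 0%N) (y 0%N) ->
  (forall k, (k.+1 < N)%N ->
    X k.+2 = itemf_next_step k.+1 (X k.+1) (y k.+1) (y k)) ->
  value N <= eta * value 0%N.
Proof.
move=> p value star chain X1 XS.
have [N1 q0 q1 eta0 eta1 a0 a1 adec b0 c0 c2 astep bstep circ bN bnd] := S.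
have q1' : 1 - q != 0 by rewrite subr_eq0 gt_eqF.
have qb0 : 0 < 1 - q by rewrite subr_gt0.
pose pot k := (1 - a k.+1) * F k +
  (dot (s k.+1 *: X k.+1 - (s k.+1 - b k.+1) *: y k)
       (s k.+1 *: X k.+1 - (s k.+1 - b k.+1) *: y k)
   + q * (1 - a k.+1) ^+ 2 * dot (y k) (y k)) / (2 * (1 - q)).
have pot0 : pot 0%N <= eta * value 0%N.
  have k1N : (1 <= 1 <= N)%N by [].
  have s10 := itemf_scale_gt0 k1N.
  have eps0 : 0 <= eta / (1 - q) by rewrite divr_ge0 ?ltW.
  have kap2 : Num.sqrt (eta * (1 - q)) ^+ 2 = (1 - q) * eta.
    by rewrite sqr_sqrtr 1?mulrC // mulr_ge0 ?ltW.
  have kapE : Num.sqrt (eta * (1 - q)) = (1 - q) * Num.sqrt (eta / (1 - q)).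
    apply/eqP; rewrite -(@eqrXn2 _ 2) ?mulr_ge0 ?sqrtr_ge0 ?(ltW qb0) //.
    by rewrite kap2 exprMn sqr_sqrtr //; apply/eqP; field.
  have kapb : Num.sqrt (eta * (1 - q)) * b 1%N = (1 - q) * (1 - a 1%N - eta).
    by rewrite kapE -mulrA; congr (_ * _); move: bnd; lra_goal.
  have b2 : b 1%N ^+ 2 = q * (1 - eta - (1 - (1 - a 1%N)) ^+ 2).
    by rewrite -(circ 1%N k1N); field; rewrite gt_eqF.
  have := potential_init_identity (X 0%N) (y 0%N) (negbT (lt_eqF q1))
    (lt0r_neq0 s10) kap2 kapb b2.
  rewrite /pot X1 /= /itemf_init_step => <-.
  (* The boundary relation makes this multiplier equal to [sqrt (eta / (1 - q)) * b 1]. *)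
  have l_eta : 0 <= 1 - a 1%N - eta.
    have : 0 <= Num.sqrt (eta / (1 - q)) * b 1%N.
      by rewrite mulr_ge0 ?sqrtr_ge0 // ltW ?b0.
    by move: bnd; lra_goal.
  move: (ler_wpM2l l_eta (star 0%N)); rewrite /value /p; lra_goal.
have pot_step k : (k.+1 < N)%N -> pot k.+1 <= pot k.
  move=> kN; have k1N : (1 <= k.+1 < N)%N by [].
  have k2N : (1 <= k.+2 <= N)%N by [].
  have l10 : 0 < 1 - a k.+2 by rewrite subr_gt0 a1.
  have cE : c k.+2 ^+ 2 = (1 - a k.+2) * (2 - q * (1 - a k.+2)).
    by rewrite c2 //; ring.
  have sE : s k.+1 = (1 - q) * (1 - a k.+2) / c k.+2.
    by rewrite /itemf_scale ltn_eqF.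
  have := potential_step_identity (b k.+2) (X k.+1) (y k.+1) (y k)
    (negbT (lt_eqF q1)) (lt0r_neq0 (itemf_scale_gt0 k2N))
    (lt0r_neq0 (c0 _ k2N)) (lt0r_neq0 l10) cE sE (itemf_scale_sub k1N).
  rewrite /pot XS // => E1.
  have l00 : 0 <= 1 - a k.+1 by rewrite subr_ge0 ltW // a1 // (ltnW kN).
  have l_inc : 0 <= 1 - a k.+2 - (1 - a k.+1).
    by move: (adec _ k1N); lra_goal.
  have H1 := ler_wpM2l l00 (chain k); have H2 := ler_wpM2l l_inc (star k.+1).
  move: E1 H1 H2; rewrite /itemf_next_step /p.
  move: (dot _ _ + _) => V1; move: (dot _ _ + _) => V0; lra_goal.
have pot_last k : k.+1 = N -> value N <= pot k.
  move=> kN.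
  have sE : s k.+1 = Num.sqrt (1 - q) by rewrite /itemf_scale kN eqxx.
  have lN : 0 <= 1 - a N by rewrite subr_ge0 ltW // a1 ?N1 /=.
  have aN : 0 <= a N by rewrite ltW // a0 ?N1 /=.
  have := ler_wpM2l aN (star N); have := ler_wpM2l lN (chain k).
  (* At the last index the quadratic form does not cancel completely: this square, divided by
     [2 * (1 - q)], is what remains. *)
  have := dot_ge0 (y N - (1 - a N) *: y k).
  rewrite -(@pmulr_rge0 _ (2 * (1 - q))^-1) ?invr_gt0 ?mulr_gt0 //.
  rewrite -subr_ge0 => H1; rewrite -subr_ge0 => H2; rewrite -subr_ge0 => H3.
  rewrite -subr_ge0; have := addr_ge0 (addr_ge0 H1 H2) H3.
  congr (0 <= _); rewrite /pot sE kN bN.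
  have -> : Num.sqrt (1 - q) - Num.sqrt (1 - q) * a N
    = Num.sqrt (1 - q) * (1 - a N) by ring.
  have -> : Num.sqrt (1 - q) *: X N - (Num.sqrt (1 - q) * (1 - a N)) *: y k
    = Num.sqrt (1 - q) *: (X N - (1 - a N) *: y k) by rewrite scalerBr scalerA.
  rewrite dotZl dotZr mulrA -expr2 sqr_sqrtr ?(ltW qb0) //.
  rewrite /value /p !dotE.
  rewrite (dotC (y k) (X N)) (dotC (y N) (X N)) (dotC (y k) (y N)).
  by field.
have pot_le k : (k < N)%N -> pot k <= pot 0%N.
  elim: k => // k IHk kN; apply: le_trans (pot_step _ kN) _.
  exact/IHk/ltnW.
apply: le_trans (pot_last N.-1 _) _; first by rewrite prednK.
by apply: le_trans (pot_le _ _) pot0; rewrite prednK.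
Qed.


Lemma itemf_guarantee f x0 xs :
  smooth_strongly_convex (q * L) L f -> (forall x, f xs <= f x) ->
  f (itemf_state f x0 N).1.2 - f xs <= eta * (f x0 - f xs).
Proof.
move=> fP fmin; have q1 := rs_q_lt1 S.
(* A gradient step from [xs] would lower [f / L] by half the squared norm of [scaled_grad],
   contradicting minimality unless it vanishes. *)
have gs : scaled_grad L f xs = 0.
  have := scaled_upper_bound L0 fP xs (xs - scaled_grad L f xs).
  have := fmin (xs - scaled_grad L f xs).
  rewrite -(@ler_pM2r _ L^-1) ?invr_gt0 // => H1 H2.
  have := le_trans H1 H2; move: (scaled_grad L f xs) => g {H1 H2}.
  have -> : xs - g - xs = - g by rewrite addrAC subrr add0r.
  rewrite !dotE => H; apply: dot_eq0; apply/eqP.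
  by rewrite eq_le dot_ge0 andbT; move: H; lra_goal.
have ys : gd_point L f xs xs = 0 by rewrite /gd_point gs subrr subr0.
have Fs : reduced_value q L f xs xs = f xs / L.
  by rewrite /reduced_value gs ys !dotE; ring.
have sub := reduced_subgradient xs q1 L0 fP.
pose X k := (itemf_state f x0 k).1.2.
have X0 : X 0%N = x0 by [].
have stE k : itemf_state f x0 k.+1
    = (k.+1, X k.+1, X k - scaled_grad L f (X k)).
  rewrite /X /=; have := itemf_state_idx f x0 k.
  by case: (itemf_state f x0 k) => -[i x] z /= ->.
have XS1 k : X k.+2 = itemf_next_step k.+1 (X k.+1)
    (X k.+1 - scaled_grad L f (X k.+1)) (X k - scaled_grad L f (X k)).
  rewrite {1}/X -[itemf_state f x0 k.+2]/(itemf_step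
    (itemf_state f x0 k.+1) (oracle f (itemf_state f x0 k.+1).1.2)).
  by rewrite {1}stE.
have X1 : X 1%N = itemf_init_step x0 (x0 - scaled_grad L f x0) by [].
rewrite -/(X N) -[in f x0]X0; clearbody X.
have [Z ZE] : exists Z, forall k, Z k = X k - xs by exists (fun k => X k - xs).
have [y yE] : exists y, forall k, y k = gd_point L f xs (X k).
  by exists (fun k => gd_point L f xs (X k)).
have [F FE] : exists F, forall k, F k = reduced_value q L f xs (X k) - f xs / L.
  by exists (fun k => reduced_value q L f xs (X k) - f xs / L).
have subF k j : F j + dot (Z j - (1 - q)^-1 *: y j) (y k - y j) <= F k.
  by rewrite !FE addrAC lerD2r ZE !yE; exact: sub.
have starF k : F k <= dot (Z k - (1 - q)^-1 *: y k) (y k).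
  have := sub xs (X k).
  by rewrite Fs ys sub0r dotNr lerBlDr -lerBlDl -FE -yE /dual_point -ZE -yE.
have gE k : scaled_grad L f (X k) = Z k - y k by rewrite ZE yE subKr.
(* The terms subtracted in [reduced_value] are added back, so the abstract [value] is the function
   gap divided by [L]. *)
have valueE k : F k + dot (Z k - y k) (Z k - y k) / 2
    + q / (2 * (1 - q)) * dot (y k) (y k) = (f (X k) - f xs) / L.
  rewrite FE /reduced_value -yE gE; move: (dot _ _) (dot _ _) => u v.
  by rewrite mulrBl; ring.
have XE k : X k = Z k + xs by rewrite ZE subrK.
have ygE k : X k - scaled_grad L f (X k) = y k + xs.
  by rewrite gE XE opprB addrC addrA subrK.
have := @itemf_potential F Z y.
rewrite /= !valueE => pot.
rewrite -(@ler_pM2r _ L^-1) ?invr_gt0 // -mulrA; apply: pot => [//|k||k kN].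
- by have := subF k k.+1; rewrite dotDr dotNr addrA.
- rewrite ZE X1 -X0 ygE XE /itemf_init_step.
  by apply/rowP => i; rewrite !mxE; ring.
- by rewrite ZE XS1 itemf_next_step_affine // !ygE !addrK XE addrK.
Qed.

Lemma minimax_risk_upper_bound (Rf : R) :
  (minimax_risk N (function_value_class d (q * L) L Rf) <= (eta * Rf)%:E)%E.
Proof.
apply: le_trans (ereal_inf_lbound _) _; first by exists itemf_method.
apply: ge_ereal_sup => _ [[f x0] [/= fP [xs fmin] gap0] <-].
rewrite lee_fin /gap itemf_run [(f, x0).1]/= [(f, x0).2]/=.
have minE := min_value_eq fmin.
rewrite minE; apply: le_trans (itemf_guarantee x0 fP fmin) _.
by rewrite ler_wpM2l ?(ltW (rs_eta_gt0 S)) // -minE.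
Qed.

End OptimalMethod.

(** * Scalars of the worst-case function *)

(* [rho] and [sigma] are the coordinates of the vertices [hard_point] and [theta]
   those of the center; [nu / (1 - eta)] are barycentric coordinates of the center,
   and [hs_ratio] compares the value at the starting point with the minimum over
   the span of the first [N] directions. *)
Record hard_sequences (R : realType) (N : nat) (q eta : R)
    (nu rho sigma theta : nat -> R) : Prop := HardSequences {
  hs_nu_ge0 : forall k, (k <= N)%N -> 0 <= nu k ;
  hs_nu_sum : \sum_(i < N.+1) nu i = 1 - eta ;
  hs_theta_gt0 : 0 < theta 0%N ;
  hs_rho_gt0 : forall k, (k <= N)%N -> 0 < rho k ;
  hs_sigma_lt : forall k, (k < N)%N -> sigma k < rho k ;
  hs_theta_next : forall k, (k < N)%N ->
    rho k.+1 * theta k.+1 = (rho k - sigma k) * (theta k - q * rho k) ;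
  hs_theta_comb : forall k, (k <= N)%N ->
    (1 - eta) * theta k
    = nu k * rho k + sigma k * \sum_(k.+1 <= i < N.+1) nu i ;
  hs_ratio :
    eta * (2 * rho 0%N * theta 0%N - q * rho 0%N ^+ 2
           - \sum_(i < N.+1) theta i ^+ 2)
    = 2 * (\sum_(i < N) sigma i * theta i + rho N * theta N)
      - \sum_(i < N.+1) theta i ^+ 2 - \sum_(i < N) sigma i ^+ 2
      - q * rho N ^+ 2 }.

Section HardSequences.
Context {R : realType}.
Variables (N : nat) (q eta : R) (a b c : nat -> R).
Hypothesis S : risk_scheme N q eta a b c.

(** The decrements of the sequence [1 - eta, a 1, .., a N, 0]; tail sums therefore collapse. *)
Definition hard_nu k : R :=
  if k == N then a N else (if k == 0%N then 1 - eta else a k) - a k.+1.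
(** The recursion for [a] solved for [c k.+1]. The formula also makes sense at index [0], with
    [1 - eta] in the role of [a 0]. *)
Definition hard_c k : R :=
  (hard_nu k + q * (1 - a k.+1) * a k.+1) / b k.+1.
(** This is [theta k / rho k], and [sigma_ratio k] is [sigma k / rho k]. Given both, [hs_theta_next]
    determines [rho] up to a scale, normalized by [rho 0 = 1]. *)
Definition theta_ratio k : R :=
  if k == N then q / a N else q * hard_c k / b k.+1.
Definition sigma_ratio k : R :=
  q * (1 - a k.+1) + a k.+1 * theta_ratio k.
Fixpoint hard_rho k : R :=
  if k is n.+1 then
    Num.sqrt (hard_rho n ^+ 2 * (1 - sigma_ratio n) * (theta_ratio n - q)
              / theta_ratio n.+1)
  else 1.

Local Notation nu := hard_nu.
Local Notation tr := theta_ratio.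
Local Notation sr := sigma_ratio.
Local Notation rho := hard_rho.

Let q0 : 0 < q. Proof. by case: S. Qed.
Let q1 : q < 1. Proof. by case: S. Qed.
Let qb0 : 0 < 1 - q. Proof. by rewrite subr_gt0. Qed.

Lemma hard_c_step k : (1 <= k < N)%N -> hard_c k = c k.+1.
Proof.
move=> kN; have /andP[k1 ltkN] := kN.
rewrite /hard_c /hard_nu ltn_eqF // (gtn_eqF k1) (rs_a_step S kN).
have := rs_b_gt0 S (_ : (1 <= k.+1 <= N)%N); rewrite ltkN => /(_ isT) b0.
by field; rewrite gt_eqF.
Qed.

Lemma sqr_lt_sqr (x y : R) : 0 < y -> x ^+ 2 < y ^+ 2 -> x < y.
Proof.
move=> y0; have [x0|x0 _] := leP 0 x; last exact: lt_trans y0.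
by rewrite ltr_pXn2r // nnegrE ltW.
Qed.

(* The boundary relation and the circle [a_1^2 + b_1^2 / q = 1 - eta] make [q],
   [eta], [a_1] and [b_1^2] rational functions of the weight [l = 1 - a_1] and of
   [x = sqrt (eta / (1 - q)) * b_1]; identities at index [0] are then proved by
   [field]. *)
Lemma boundary_param : exists l x : R,
  [/\ 0 < l < 1, 0 < x, a 1%N = 1 - l & eta = l - x] /\
  q = x ^+ 2 / (l ^+ 2 * (1 - l + x)) /\ b 1%N ^+ 2 = q * ((1 - l) * l + x).
Proof.
have k1N : (1 <= 1 <= N)%N by case: S.
have a0 := rs_a_gt0 S k1N; have a1 := rs_a_lt1 S k1N; have b0 := rs_b_gt0 S k1N.
have bnd := rs_boundary S; have circ := rs_circle S k1N.
have eta0 := rs_eta_gt0 S.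
exists (1 - a 1%N), (Num.sqrt (eta / (1 - q)) * b 1%N).
have x0 : 0 < Num.sqrt (eta / (1 - q)) * b 1%N.
  by rewrite mulr_gt0 // sqrtr_gt0 divr_gt0.
have x2 : (Num.sqrt (eta / (1 - q)) * b 1%N) ^+ 2
    = eta / (1 - q) * b 1%N ^+ 2.
  by rewrite exprMn sqr_sqrtr // divr_ge0 ?ltW.
move: x0 x2 bnd; move: (Num.sqrt _ * _) => x x0 x2 bnd.
have b2 : b 1%N ^+ 2 = q * ((1 - (1 - a 1%N)) * (1 - a 1%N) + x).
  apply: (mulIf (invr_neq0 (lt0r_neq0 q0))).
  by rewrite [RHS]mulrC mulKf ?gt_eqF //; move: circ bnd; lra.
split; first by split => //; move: bnd a0 a1; lra.
split=> //.
have l0 : 0 < 1 - a 1%N by rewrite subr_gt0.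
have den : 0 < (1 - a 1%N) ^+ 2 * (1 - (1 - a 1%N) + x).
  by rewrite mulr_gt0 ?exprn_gt0 // subKr addr_gt0.
apply: (mulIf (lt0r_neq0 den)); rewrite divfK ?gt_eqF //.
have etaE : eta = 1 - a 1%N - x by move: bnd; lra.
move: x2; rewrite b2 etaE => x2.
have {}x2 : (1 - q) * x ^+ 2
    = (1 - a 1%N - x) * (q * ((1 - (1 - a 1%N)) * (1 - a 1%N) + x)).
  by rewrite x2; field; rewrite gt_eqF.
move: x2; lra.
Qed.

(** Equivalent to [b k.+1 < hard_c k]. For positive [k] the circle relation gives [c ^+ 2 - b ^+ 2 =
    2 * (1 - q) * (1 - a) + q * eta] at index [k.+1]; for [k = 0] the difference, multiplied by
    [b 1], is [(1 - q) * x]. *)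
Lemma theta_ratio_gt k : (k < N)%N -> q < tr k.
Proof.
move=> kN; have k1N : (1 <= k.+1 <= N)%N by [].
have b0 := rs_b_gt0 S k1N.
rewrite /tr ltn_eqF // -mulrA ltr_pMr // ltr_pdivlMr // mul1r.
case: k kN k1N b0 => [|k] kN k1N b0.
  have [l [x [[/andP[l0 l1] x0 aE etaE] [qE b2]]]] := boundary_param.
  rewrite /hard_c /hard_nu ltn_eqF //= ltr_pdivlMr // -expr2 b2 etaE aE.
  rewrite -subr_gt0.
  suff -> : 1 - (l - x) - (1 - l) + q * (1 - (1 - l)) * (1 - l)
    - q * ((1 - l) * l + x) = (1 - q) * x by rewrite mulr_gt0.
  by ring.
rewrite hard_c_step //; have c0 := rs_c_gt0 S k1N.
apply: sqr_lt_sqr => //; rewrite (rs_c_sqr S k1N).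
have := rs_circle S k1N; have := rs_eta_gt0 S; have := rs_a_lt1 S k1N.
move: (a k.+2) (b k.+2) => A B A1 eta0 circ.
have -> : B ^+ 2 = q * (1 - eta - A ^+ 2) by rewrite -circ; field; rewrite gt_eqF.
have : 0 < q * eta by rewrite mulr_gt0.
have : 0 < (1 - q) * (1 - A) by rewrite mulr_gt0 // subr_gt0.
by lra.
Qed.

Lemma theta_ratio_gt0 k : (k <= N)%N -> 0 < tr k.
Proof.
rewrite leq_eqVlt => /orP[/eqP -> |/theta_ratio_gt]; last exact: lt_trans.
rewrite /tr eqxx divr_gt0 //; case: S => N1 _ _ _ _ a0 *; apply: a0.
by rewrite N1 leqnn.
Qed.

(** For positive [k] the recursion for [b] gives [1 - sigma_ratio k = b k / b k.+1]; index [0] is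
    computed from the boundary parameters. *)
Lemma sigma_ratio_lt1 k : (k < N)%N -> sr k < 1.
Proof.
move=> kN; have k1N : (1 <= k.+1 <= N)%N by [].
have b0 := rs_b_gt0 S k1N.
rewrite /sr /tr ltn_eqF // -subr_gt0.
case: k kN k1N b0 => [|k] kN k1N b0.
  have [l [x [[/andP[l0 l1] x0 aE etaE] [qE b2]]]] := boundary_param.
  rewrite /hard_c /hard_nu ltn_eqF //= etaE aE.
  have -> : 1 - (q * (1 - (1 - l)) + (1 - l) * (q * ((1 - (l - x) - (1 - l) +
      q * (1 - (1 - l)) * (1 - l)) / b 1%N) / b 1%N))
    = (b 1%N ^+ 2 * (1 - q * l) - (1 - l) * q * (x + q * l * (1 - l))) / b 1%N ^+ 2.
    by field; rewrite gt_eqF.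
  rewrite divr_gt0 ?exprn_gt0 // b2.
  have -> : q * ((1 - l) * l + x) * (1 - q * l)
      - (1 - l) * q * (x + q * l * (1 - l)) = q * (1 - q) * (l * (1 - l + x)).
    by ring.
  by rewrite !mulr_gt0 // addr_gt0 // subr_gt0.
rewrite hard_c_step //.
have -> : 1 - (q * (1 - a k.+2) + a k.+2 * (q * c k.+2 / b k.+2))
    = b k.+1 / b k.+2.
  by rewrite (rs_b_step S (_ : (1 <= k.+1 < N)%N)) //; field; rewrite gt_eqF.
by rewrite divr_gt0 // (rs_b_gt0 S) //=; apply: ltnW.
Qed.

Lemma hard_rho_gt0 k : (k <= N)%N -> 0 < rho k.
Proof.
elim: k => [//|k IHk] kN; rewrite /= sqrtr_gt0.
rewrite divr_gt0 ?theta_ratio_gt0 // !mulr_gt0 ?exprn_gt0 ?IHk ?(ltnW kN) //.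
  by rewrite subr_gt0 sigma_ratio_lt1.
by rewrite subr_gt0 theta_ratio_gt.
Qed.

Lemma hard_rho_sqr k : (k < N)%N ->
  rho k.+1 ^+ 2 * tr k.+1 = rho k ^+ 2 * (1 - sr k) * (tr k - q).
Proof.
move=> kN; have := hard_rho_gt0 kN; rewrite /= sqrtr_gt0 => /ltW/sqr_sqrtr ->.
by rewrite divfK // gt_eqF // theta_ratio_gt0.
Qed.

Lemma hard_nu_tail k : (k <= N)%N ->
  \sum_(k.+1 <= i < N.+1) nu i = if k == N then 0 else a k.+1.
Proof.
move=> kN; rewrite -(subKn kN); elim: (N - k)%N (leq_subr k N) => [|m IHm] mN.
  by rewrite subn0 eqxx big_geq.
rewrite subnSK // big_ltn; last by rewrite ltnS leq_subr.
rewrite IHm ?(ltnW mN) //.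
have m1 : (N - m.+1 < N)%N by rewrite -subn_gt0 subKn.
rewrite (ltn_eqF m1) /hard_nu; case: eqP => [->|_]; first by rewrite addr0.
by rewrite gtn_eqF ?subn_gt0 // subrK.
Qed.

(** This is [hs_theta_comb] divided by [rho k]; it follows by writing [1 - eta] through the circle
    relation at [k.+1]. *)
Lemma theta_ratio_comb k : (k < N)%N -> (1 - eta) * tr k = nu k + a k.+1 * sr k.
Proof.
move=> kN; have k1N : (1 <= k.+1 <= N)%N by [].
have b0 := rs_b_gt0 S k1N.
rewrite /sr /tr ltn_eqF // -(rs_circle S k1N) /hard_c.
by field; rewrite !gt_eqF.
Qed.

Lemma nu_circle_N : (1 - eta) * tr N = a N.
Proof.
have [N1 _ _ _ _ a0 *] := S; have kN : (1 <= N <= N)%N by rewrite N1 leqnn.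
have := rs_circle S kN; rewrite (rs_b_last S) exprMn sqr_sqrtr ?ltW // => <-.
by rewrite /tr eqxx; field; rewrite !gt_eqF // a0.
Qed.

(** For [k < N] this is [(1 - eta) * theta k ^+ 2 - 2 * sigma k * theta k + sigma k ^+ 2], rewritten
    by [theta_ratio_comb]. These are the summands of [hs_ratio], and in this form they telescope. *)
Definition ratio_term k : R :=
  rho k ^+ 2 * (nu k * tr k + a k.+1 * sr k * tr k - 2 * sr k * tr k + sr k ^+ 2).

Lemma ratio_term_step k : (1 <= k < N)%N -> ratio_term k
  = 2 * (1 - a k.+1) * (rho k.+1 ^+ 2 * tr k.+1)
    - 2 * (1 - a k) * (rho k ^+ 2 * tr k).
Proof.
move=> kN; have /andP[k1 ltkN] := kN; have k1N : (1 <= k.+1 <= N)%N by [].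
rewrite hard_rho_sqr // /ratio_term /sr /nu /tr (ltn_eqF ltkN) (gtn_eqF k1).
rewrite hard_c_step // (rs_a_step S kN).
have b0 := rs_b_gt0 S k1N; have l0 := rs_a_lt1 S k1N; have c2 := rs_c_sqr S k1N.
have := rs_c_gt0 S k1N.
move: (a k.+1) (b k.+1) (c k.+1) (rho k) b0 l0 c2 => A B C r b0 l0 c2 c0.
have {l0}l0 : 1 - A != 0 by rewrite subr_eq0 gt_eqF.
have qE : q = (2 * (1 - A) - C ^+ 2) / (1 - A) ^+ 2 by rewrite c2; field.
by rewrite qE; field; rewrite l0 gt_eqF.
Qed.

Lemma ratio_term0 : ratio_term 0 = 2 * (1 - a 1%N) * (rho 1%N ^+ 2 * tr 1%N)
  - 2 * eta * (rho 0%N ^+ 2 * tr 0%N) + eta * q * rho 0%N ^+ 2.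
Proof.
have N1 := rs_N S; rewrite hard_rho_sqr // /ratio_term /sr /tr (ltn_eqF N1).
have [l [x [[/andP[l0 l1] x0 aE etaE] [qE b2]]]] := boundary_param.
have -> : hard_c 0 = (x + q * l * (1 - l)) / b 1%N.
  rewrite /hard_c /hard_nu (ltn_eqF N1) eqxx /= aE etaE; congr (_ / _); ring.
have -> : hard_nu 0 = x by rewrite /hard_nu (ltn_eqF N1) eqxx /= aE etaE; ring.
rewrite -[q * (_ / b 1%N) / b 1%N]mulrA -[_ / b 1%N / b 1%N]mulrA.
rewrite -invfM -expr2 b2 aE etaE.
have h1 : 1 - l + x != 0 by rewrite gt_eqF // addr_gt0 // subr_gt0.
have h2 : (1 - l) * l + x != 0.
  by rewrite gt_eqF // addr_gt0 // mulr_gt0 // subr_gt0.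
move: (rho 0%N) => r; rewrite qE.
by field; rewrite h1 h2 !gt_eqF.
Qed.

Lemma sum_ratio_term n : (n < N)%N -> \sum_(k < n.+1) ratio_term k
  = 2 * (1 - a n.+1) * (rho n.+1 ^+ 2 * tr n.+1)
    - 2 * eta * (rho 0%N ^+ 2 * tr 0%N) + eta * q * rho 0%N ^+ 2.
Proof.
elim: n => [_|n IHn nN]; first by rewrite big_ord1 ratio_term0.
rewrite big_ord_recr IHn ?(ltnW nN) // [nat_of_ord _]/= ratio_term_step //.
move: (_ * tr n.+2) (_ * tr n.+1) (_ * tr 0%N) => u v w.
by rewrite /=; ring.
Qed.

Lemma hard_sequences_of_scheme :
  hard_sequences N q eta nu rho (fun k => sr k * rho k) (fun k => tr k * rho k).
Proof.
have N1 := rs_N S.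
have NN : (1 <= N <= N)%N by rewrite N1 leqnn.
have aN := rs_a_gt0 S NN.
have [l [x [[/andP[l0 l1] x0 aE etaE] _]]] := boundary_param.
split.
- move=> k kN; rewrite /hard_nu; case: eqP => [_|/eqP kneN]; first exact: ltW.
  have ltkN : (k < N)%N by rewrite ltn_neqAle kneN.
  case: eqP => [->|/eqP k0]; first by rewrite aE etaE subr_ge0; move: x0; lra.
  by rewrite subr_ge0 ltW // (rs_a_dec S) // lt0n k0.
- rewrite -(big_mkord xpredT nu) big_ltn // hard_nu_tail // (ltn_eqF N1).
  by rewrite /hard_nu (ltn_eqF N1) eqxx subrK.
- by rewrite mulr_gt0 ?theta_ratio_gt0 // hard_rho_gt0.
- exact: hard_rho_gt0.
- move=> k kN; rewrite gtr_pMl ?sigma_ratio_lt1 // hard_rho_gt0 //.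
  exact: ltnW.
- move=> k kN; rewrite mulrCA -expr2 mulrC hard_rho_sqr //.
  ring.
- move=> k; rewrite leq_eqVlt => /orP[/eqP ->|kN].
    by rewrite big_geq // mulr0 addr0 mulrA nu_circle_N /hard_nu eqxx.
  rewrite hard_nu_tail ?(ltnW kN) // (ltn_eqF kN) mulrA theta_ratio_comb //.
  ring.
(* Besides the telescoped sum only index [N] remains; there [a N * theta_ratio N = q] turns the
   terms carrying [a N] into multiples of [q * rho N ^+ 2]. *)
- have := sum_ratio_term (_ : (N.-1 < N)%N); rewrite prednK // => /(_ (leqnn _)).
  have <- : (1 - eta) * (\sum_(k < N) (tr k * rho k) ^+ 2)
      - 2 * (\sum_(k < N) sr k * rho k * (tr k * rho k))
      + \sum_(k < N) (sr k * rho k) ^+ 2 = \sum_(k < N) ratio_term k.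
    rewrite !mulr_sumr -sumrB -big_split; apply: eq_bigr => k _ /=.
    have -> : (1 - eta) * (tr k * rho k) ^+ 2
      = rho k ^+ 2 * tr k * ((1 - eta) * tr k) by ring.
    by rewrite theta_ratio_comb // /ratio_term; ring.
  rewrite big_ord_recr /=.
  have : (1 - eta) * (tr N * rho N) ^+ 2 = a N * tr N * rho N ^+ 2.
    by rewrite exprMn [tr N ^+ 2]expr2 !mulrA nu_circle_N.
  have : a N * tr N = q by rewrite /tr eqxx mulrC divfK // gt_eqF.
  move=> E1; rewrite E1 => E2 E3.
  have E4 : a N * (rho N ^+ 2 * tr N) = q * rho N ^+ 2.
    by rewrite mulrCA E1 mulrC.
  move: E2 E3 E4.
  move: (\sum_(k < N) (tr k * rho k) ^+ 2) (\sum_(k < N) (sr k * rho k) ^+ 2).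
  move: (\sum_(k < N) sr k * rho k * (tr k * rho k)) => X Y W.
  by lra.
Qed.

End HardSequences.

(** Each relation is homogeneous in [rho], [sigma] and [theta]; the free factor later tunes the
    initial gap to [Rf]. *)
Lemma hard_sequences_scale (R : realType) (N : nat) (q eta s : R)
    (nu rho sigma theta : nat -> R) : 0 < s ->
  hard_sequences N q eta nu rho sigma theta ->
  hard_sequences N q eta nu (fun k => s * rho k) (fun k => s * sigma k)
    (fun k => s * theta k).
Proof.
move=> s0 [nu0 nu1 th0 rho_gt0 sigma_lt next comb ratio]; split => //.
- exact: mulr_gt0.
- by move=> k kN; rewrite mulr_gt0 // rho_gt0.
- by move=> k kN; rewrite ltr_pM2l // sigma_lt.
- move=> k kN; transitivity (s ^+ 2 * (rho k.+1 * theta k.+1)); first by ring.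
  by rewrite next //; ring.
- by move=> k kN; rewrite mulrCA comb //; ring.
- have sq n (u v : nat -> R) : \sum_(i < n) (s * u i) * (s * v i)
      = s ^+ 2 * \sum_(i < n) u i * v i.
    by rewrite mulr_sumr; apply: eq_bigr => i _; ring.
  have sq2 n (u : nat -> R) : \sum_(i < n) (s * u i) ^+ 2
      = s ^+ 2 * \sum_(i < n) u i ^+ 2.
    by rewrite mulr_sumr; apply: eq_bigr => i _; ring.
  rewrite sq !sq2; move: ratio; move: (\sum_(i < N.+1) _) (\sum_(i < N) _).
  move: (\sum_(i < N) _) => X Y Z ratio.
  have : s ^+ 2 * (eta * (2 * rho 0%N * theta 0%N - q * rho 0%N ^+ 2 - Y))
    = s ^+ 2 * (2 * (Z + rho N * theta N) - Y - X - q * rho N ^+ 2).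
    by rewrite ratio.
  by lra.
Qed.

(** * Projection on a polytope *)

Section PolytopeProjection.
Context {R : realType} {m : nat}.
Local Notation V := 'rV[R]_m.
Implicit Types (t : nat -> V) (y p : V) (n : nat).

Definition conv_hull n t p : Prop := exists l : nat -> R,
  [/\ forall i, 0 <= l i, \sum_(i < n.+1) l i = 1
    & p = \sum_(i < n.+1) l i *: t i].

(** The variational characterization, tested on the vertices alone so that it can be checked one
    vertex at a time; [is_projection_hull] extends it to the hull. *)
Definition is_projection n t y p : Prop :=
  conv_hull n t p /\ forall i, (i <= n)%N -> dot (t i - p) (y - p) <= 0.

Lemma is_projection_hull n t y p x :
  is_projection n t y p -> conv_hull n t x -> dot (x - p) (y - p) <= 0.
Proof.
move=> [_ H] [l [l0 l1 ->]].
have -> : \sum_(i < n.+1) l i *: t i - p = \sum_(i < n.+1) l i *: (t i - p).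
  rewrite -{1}[p]scale1r -l1 scaler_suml -sumrB.
  by apply: eq_bigr => i _; rewrite scalerBr.
rewrite dot_suml; apply: sumr_le0 => i _; rewrite dotZl.
by rewrite mulr_ge0_le0 ?l0 // H // -ltnS.
Qed.

(** Firm nonexpansiveness: add the two variational inequalities, each tested at the other
    projection. *)
Lemma is_projection_firm n t y z p r :
  is_projection n t y p -> is_projection n t z r ->
  dot (p - r) (p - r) <= dot (p - r) (y - z).
Proof.
move=> Hp Hr; have := is_projection_hull Hp (proj1 Hr).
have := is_projection_hull Hr (proj1 Hp).
rewrite !dotE (dotC r p); lra.
Qed.

Lemma is_projection_unique n t y p r :
  is_projection n t y p -> is_projection n t y r -> p = r.
Proof.
move=> Hp Hr; have := is_projection_firm Hp Hr; rewrite subrr dot0r => H.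
by apply/eqP; rewrite -subr_eq0; apply/eqP/dot_eq0/eqP; rewrite eq_le H dot_ge0.
Qed.

Lemma simplex_compact n :
  compact [set v : 'rV[R]_n.+1 |
    (forall i, 0 <= v 0 i) /\ \sum_i v 0 i = 1].
Proof.
have coordc i : continuous (fun v : 'rV[R]_n.+1 => v 0 i) by exact: coord_continuous.
have sumc : continuous (fun v : 'rV[R]_n.+1 => \sum_i v 0 i).
  have addc : continuous (fun z : R * R => z.1 + z.2) by exact: add_continuous.
  exact: (continuous_big addc (fun i _ => coordc i)).
apply: bounded_closed_compact.
  exists 1; split => // M M1 v [v0 v1].
  rewrite /= [leLHS]mx_normrE; apply: bigmax_le; first by rewrite (le_trans _ (ltW M1)).
  move=> [i j] _ /=; rewrite ord1 ger0_norm //; apply: le_trans (ltW M1).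
  by rewrite -v1 (bigD1 j) //= lerDl sumr_ge0.
have -> : [set v : 'rV[R]_n.+1 | (forall i, 0 <= v 0 i) /\ \sum_i v 0 i = 1]
  = (\bigcap_(i in [set: 'I_n.+1]) [set v : 'rV[R]_n.+1 | 0 <= v 0 i])
    `&` ((fun v : 'rV[R]_n.+1 => \sum_i v 0 i) @^-1` [set 1]).
  apply/seteqP; split=> v /= [v0 v1]; split=> //; first by move=> i _; exact: v0.
  by move=> i; exact: v0.
apply: closedI; last first.
  by apply: preimage_closed => // x _; exact: sumc.
apply: closed_bigI => i _.
have -> : [set v : 'rV[R]_n.+1 | 0 <= v 0 i] = (fun v => v 0 i) @^-1` [set x | 0 <= x].
  by [].
by apply: preimage_closed => [x _|]; [exact: coordc | exact: closed_ge].
Qed.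

(** The function [g] is half of [|y|^2 - |y - comb v|^2]; it attains its maximum on the compact
    simplex of barycentric coordinates. Moving from the maximizer slightly toward a vertex yields
    the variational inequality. *)
Lemma projection_exists n t y : exists p, is_projection n t y p.
Proof.
pose comb (v : 'rV[R]_n.+1) : V := \sum_(i < n.+1) v 0 i *: t i.
pose g (v : 'rV[R]_n.+1) := dot y (comb v) - dot (comb v) (comb v) / 2.
pose A := [set v : 'rV[R]_n.+1 | (forall i, 0 <= v 0 i) /\ \sum_i v 0 i = 1].
have combj j (v : 'rV[R]_n.+1) : comb v 0 j = \sum_(i < n.+1) v 0 i * t i 0 j.
  by rewrite /comb summxE; apply: eq_bigr => i _; rewrite mxE.
have addc : continuous (fun z : R * R => z.1 + z.2) by exact: add_continuous.
have combc j : continuous (fun v => comb v 0 j).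
  have -> : (fun v => comb v 0 j) = (fun v : 'rV[R]_n.+1 =>
      \sum_(i < n.+1) v 0 i * t i 0 j) by apply/funext => v; exact: combj.
  have Fc i : xpredT i -> continuous (fun v : 'rV[R]_n.+1 => v 0 i * t i 0 j).
    move=> _ v.
    apply: (@continuousM _ _ (fun y : 'rV[R]_n.+1 => y 0 i) (fun=> t i 0 j)).
      exact: coord_continuous.
    exact: cst_continuous.
  exact: (continuous_big addc Fc).
have gc : continuous g.
  have F1 i : xpredT i -> continuous (fun v => y 0 i * comb v 0 i).
    move=> _ v; apply: (@continuousM _ _ (fun=> y 0 i) (fun v => comb v 0 i)).
      exact: cst_continuous.
    exact: combc.
  have F2 i : xpredT i -> continuous (fun v => comb v 0 i * comb v 0 i).
    by move=> _ v; apply: (@continuousM _ _ (fun v => comb v 0 i)); exact: combc.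
  have c1 := continuous_big (x0 := 0) (r := index_enum _) addc F1.
  have c2 := continuous_big (x0 := 0) (r := index_enum _) addc F2.
  move=> v; apply: (@continuousB _ _ _ (fun v => dot y (comb v))
    (fun v => dot (comb v) (comb v) / 2)); first exact: c1.
  apply: (@continuousM _ _ (fun v => dot (comb v) (comb v)) (fun=> 2^-1)).
    exact: c2.
  exact: cst_continuous.
have A0 : A !=set0.
  exists (delta_mx 0 ord0); split=> [i|]; first by rewrite mxE ler0n.
  rewrite (bigD1 ord0) //= mxE !eqxx big1 ?addr0 // => i i0.
  by rewrite mxE (negbTE i0) andbF.
have [v /set_mem [v0 v1] vmax] := compact_EVT_max A0 (@simplex_compact n)
  (continuous_subspaceT gc).
exists (comb v); split.
  exists (fun i => if (i < n.+1)%N then v 0 (inord i) else 0); split.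
  - by move=> i; case: ifP.
  - by rewrite -v1; apply: eq_bigr => i _; rewrite ltn_ord inord_val.
  - by apply: eq_bigr => i _; rewrite ltn_ord inord_val.
move=> i iN.
pose w : 'rV[R]_n.+1 := delta_mx 0 (inord i).
have combw : comb w = t i.
  rewrite /comb (bigD1 (inord i)) //= mxE !eqxx scale1r inordK // big1 ?addr0 //.
  by move=> j ji; rewrite mxE (negbTE ji) andbF scale0r.
apply: (@le_of_linear_slack _ _ _ (dot (t i - comb v) (t i - comb v) / 2)) => s.
move=> /andP[s0 s1].
have combD : comb ((1 - s) *: v + s *: w) = comb v + s *: (t i - comb v).
  have -> : comb ((1 - s) *: v + s *: w) = (1 - s) *: comb v + s *: comb w.
    rewrite /comb !scaler_sumr -big_split; apply: eq_bigr => j _ /=.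
    by rewrite !mxE !scalerA scalerDl.
  by rewrite combw; apply/rowP => j; rewrite !mxE; ring.
have := vmax ((1 - s) *: v + s *: w); rewrite inE => H.
have {}H : g ((1 - s) *: v + s *: w) <= g v.
  apply: H; split=> [j|].
    by rewrite !mxE addr_ge0 // mulr_ge0 ?subr_ge0 ?v0 ?ler0n // ltW.
  transitivity (\sum_j ((1 - s) * v 0 j + s * w 0 j)).
    by apply: eq_bigr => j _; rewrite !mxE.
  rewrite big_split -!mulr_sumr v1 (bigD1 (inord i)) //= mxE !eqxx.
  rewrite big1 => [|j ji]; last by rewrite mxE (negbTE ji) andbF.
  by rewrite /=; ring.
rewrite add0r -(ler_pM2l s0); move: H; rewrite /g combD.
move: (comb v) (t i - comb v) => c h {combD combw}.
rewrite !dotE (dotC h c) (dotC h y); lra.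
Qed.

Definition projection n t y : V := xget 0 [set p | is_projection n t y p].

Lemma projectionP n t y : is_projection n t y (projection n t y).
Proof. by have [p Hp] := projection_exists n t y; exact: (xgetPex 0 (ex_intro _ p Hp)). Qed.

Lemma projection_eq n t y p : is_projection n t y p -> projection n t y = p.
Proof. exact/is_projection_unique/projectionP. Qed.

(** The maximum of [dot y x - dot x x / 2] over the hull, that is half of
    [|y|^2 - dist (y, conv t)^2]; a convex function whose gradient is the projection. *)
Definition hull_envelope n t y : R :=
  dot y (projection n t y) - dot (projection n t y) (projection n t y) / 2.

Lemma hull_envelope_ge n t y x : conv_hull n t x ->
  dot y x - dot x x / 2 <= hull_envelope n t y.
Proof.
move=> /(is_projection_hull (projectionP n t y)); rewrite /hull_envelope.
have := dot_ge0 (x - projection n t y).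
rewrite !dotE (dotC y x) (dotC y (projection _ _ _)) (dotC _ x); lra.
Qed.

(** The lower bound tests the envelope at [y + h] on the projection of [y]. The upper bound combines
    the variational inequality at [y] with the square of [h] minus the displacement of the
    projection. *)
Lemma hull_envelope_expansion n t y h :
  0 <= hull_envelope n t (y + h) - hull_envelope n t y
       - dot (projection n t y) h <= dot h h / 2.
Proof.
have H1 := hull_envelope_ge (y + h) (proj1 (projectionP n t y)).
have H2 := is_projection_hull (projectionP n t y)
  (proj1 (projectionP n t (y + h))).
apply/andP; split.
  move: H1; rewrite /hull_envelope !dotE (dotC _ h); lra.
have := dot_ge0 (h - (projection n t (y + h) - projection n t y)).
move: H2; rewrite /hull_envelope; clear H1.
move: (projection n t (y + h)) (projection n t y) => u v.
rewrite !dotE (dotC u y) (dotC v y) (dotC v u) (dotC u h) (dotC v h); lra.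
Qed.

End PolytopeProjection.

(** * Functions defined by a polytope *)

Section HullFunction.
Context {R : realType} {m d : nat}.
Variables (n : nat) (t : nat -> 'rV[R]_m) (q L C0 : R) (ctr : 'rV[R]_m).
Implicit Types (E : 'M[R]_(m, d)) (u v : 'rV[R]_m) (w h : 'rV[R]_d).

(* Up to the constant and with [ctr = 0], [m = d] and [E = 1%:M], this is
   [L * (|w|^2 / 2 - (1 - q) / 2 * dist (w, conv t)^2)]. *)
Definition hull_function E w : R :=
  L * (C0 + q / 2 * dot w w + (1 - q) * hull_envelope n t (ctr + w *m E^T)).

Definition hull_gradient E w : 'rV[R]_d :=
  L *: (q *: w + (1 - q) *: (projection n t (ctr + w *m E^T) *m E)).

Lemma dot_mulmx E u w : dot w (u *m E) = dot (w *m E^T) u.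
Proof.
have dotM k (x y : 'rV[R]_k) : dot x y = (x *m y^T) 0 0.
  by rewrite mxE; apply: eq_bigr => i _; rewrite mxE.
by rewrite !dotM trmx_mul mulmxA.
Qed.

Variable E : 'M[R]_(m, d).
Hypothesis EE : E *m E^T = 1%:M.
Hypotheses (q0 : 0 < q) (q1 : q < 1) (L0 : 0 < L).

Lemma dot_isometry u v : dot (u *m E) (v *m E) = dot u v.
Proof. by rewrite dot_mulmx -mulmxA EE mulmx1. Qed.

Lemma bessel w : dot (w *m E^T) (w *m E^T) <= dot w w.
Proof.
have := dot_ge0 (w - w *m E^T *m E).
rewrite !dotE dot_isometry (dotC _ w) dot_mulmx; lra.
Qed.

(** The envelope contributes a remainder between [0] and half of [|h *m E^T|^2], which [bessel]
    bounds by half of [|h|^2]; the quadratic term adds its exact share [q]. *)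
Lemma hull_function_expansion w h :
  q * L / 2 * dot h h <= hull_function E (h + w) - hull_function E w
    - dot (hull_gradient E w) h <= L / 2 * dot h h.
Proof.
have := hull_envelope_expansion n t (ctr + w *m E^T) (h *m E^T).
have -> : ctr + w *m E^T + h *m E^T = ctr + (h + w) *m E^T.
  by rewrite mulmxDl -addrA [w *m _ + _]addrC.
rewrite /hull_function /hull_gradient.
move: (hull_envelope _ _ (_ + (_ + _) *m _)) => S1.
move: (hull_envelope _ _ _) (projection _ _ _) => S0 p /andP[H1 H2].
have := bessel h; rewrite !dotE (dotC (p *m E) h) dot_mulmx [dot (h *m _) p]dotC.
move: H1 H2; move: (dot (h *m _) _) (dot p _) => hh ph H1 H2 H3.
rewrite (dotC w h).
have G1 : 0 <= L * (1 - q) * (S1 - S0 - ph).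
  by rewrite mulr_ge0 // mulr_ge0 ?subr_ge0 // ltW.
have G2 : 0 <= L * (1 - q) * (dot h h / 2 - (S1 - S0 - ph)).
  rewrite mulr_ge0 ?mulr_ge0 ?subr_ge0 ?(ltW L0) ?(ltW q1) //.
  by apply: le_trans H2 _; rewrite ler_pM2r.
by apply/andP; split; move: G1 G2; lra.
Qed.

Lemma gradient_hull_function w :
  differentiable (hull_function E) w /\
  gradient (hull_function E) w = hull_gradient E w.
Proof.
apply: (@gradient_of_expansion _ _ _ _ _ (L / 2)) => h.
have /andP[H1 H2] := hull_function_expansion w h.
rewrite ger0_norm // (le_trans _ H1) // !mulr_ge0 ?dot_ge0 ?invr_ge0 ?ltW //.
Qed.

Lemma enorm_le (x y : 'rV[R]_d) (k : R) : 0 <= k ->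
  dot x x <= k ^+ 2 * dot y y -> enorm x <= k * enorm y.
Proof.
move=> k0 H; rewrite -(@ler_pXn2r _ 2) ?nnegrE ?mulr_ge0 ?enorm_ge0 //.
by rewrite exprMn !enorm_sqr.
Qed.

Lemma hull_function_smooth_strongly_convex :
  smooth_strongly_convex (q * L) L (hull_function E).
Proof.
split=> [w|x y s /andP[s0 s1]|x y]; first by have [] := gradient_hull_function w.
  set z := s *: x + (1 - s) *: y.
  have /andP[Hx _] := hull_function_expansion z (x - z).
  have /andP[Hy _] := hull_function_expansion z (y - z).
  move: Hx Hy; rewrite !subrK.
  have -> : x - z = (1 - s) *: (x - y).
    by rewrite /z; apply/rowP => i; rewrite !mxE; ring.
  have -> : y - z = (- s) *: (x - y).
    by rewrite /z; apply/rowP => i; rewrite !mxE; ring.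
  rewrite enorm_sqr; move: (hull_gradient E z) (x - y) => g v.
  rewrite [dot ((1 - s) *: v) _]dotZl [dot v ((1 - s) *: v)]dotZr.
  rewrite [dot (- s *: v) _]dotZl [dot v (- s *: v)]dotZr !(dotZr _ g v).
  move: (dot v v) (dot g v) (hull_function E x) (hull_function E y)
    (hull_function E z) => vv gv fx fy fz Hx Hy.
  have s1' : 0 <= 1 - s by rewrite subr_ge0.
  by move: (ler_wpM2l s0 Hx) (ler_wpM2l s1' Hy); lra.
have [_ ->] := gradient_hull_function x; have [_ ->] := gradient_hull_function y.
apply: enorm_le; first exact: ltW.
(* With [D = x - y] and [P] the difference of the projections, firmness gives
   [dot P P <= dot (D *m E^T) P <= dot D D], so the combination of [D] and [P *m E] with weights [q]
   and [1 - q] is no longer than [D]. *)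
have H := is_projection_firm (projectionP n t (ctr + x *m E^T))
  (projectionP n t (ctr + y *m E^T)).
rewrite /hull_gradient -scalerBr dotZl dotZr mulrA -expr2.
rewrite ler_wpM2l ?sqr_ge0 //.
move: H; rewrite opprD addrACA subrr add0r -mulmxBl.
move: (projection _ _ _) (projection _ _ _) => r p.
rewrite opprD addrACA -!scalerBr -mulmxBl.
move: (x - y) (p - r) => D P H.
have H3 := bessel D; have H4 := dot_ge0 (D *m E^T - P).
rewrite !dotE dot_isometry [dot (P *m E) D]dotC !dot_mulmx.
move: H H3 H4; rewrite !dotE (dotC P (D *m E^T)).
move: (dot P P) (dot (D *m E^T) P) (dot (D *m E^T) (D *m E^T)) (dot D D).
move=> PP PD WW DD H H3 H4.
have {}H4 : PD <= DD by lra.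
have H5 : 0 <= q * (1 - q) * (DD - PD).
  by rewrite mulr_ge0 ?subr_ge0 // mulr_ge0 ?subr_ge0 // ltW.
have H6 : 0 <= (1 - q) ^+ 2 * (DD - PP).
  by rewrite mulr_ge0 ?sqr_ge0 // subr_ge0 (le_trans H).
by move: H5 H6; lra.
Qed.

End HullFunction.

(** * The worst-case polytope *)

Section HardInstance.
Context {R : realType}.
Variables (N : nat) (q eta : R) (nu rho sigma theta : nat -> R).
Hypothesis H : hard_sequences N q eta nu rho sigma theta.
Hypotheses (q0 : 0 < q) (q1 : q < 1) (eta1 : eta < 1).
Local Notation V := 'rV[R]_N.+1.

Definition hard_point i : V :=
  \row_j (if (j < i)%N then sigma j else if j == i :> nat then rho i else 0).

Definition hard_center : V := \row_j theta j.

Lemma hard_point_gt i (j : 'I_N.+1) : (i < j)%N -> hard_point i 0 j = 0.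
Proof. by move=> ij; rewrite mxE ltnNge (ltnW ij) /= gtn_eqF. Qed.

Lemma hard_pointS k : (k < N)%N -> hard_point k.+1 = hard_point k
  + (sigma k - rho k) *: delta_mx 0 (inord k)
  + rho k.+1 *: delta_mx 0 (inord k.+1).
Proof.
move=> kN; apply/rowP => j; rewrite !mxE /= ltnS leq_eqVlt.
rewrite -!val_eqE /= !inordK ?ltnS ?(ltnW kN) //.
case: (ltngtP j k) => [jk|jk|->].
- by rewrite ltn_eqF ?(ltn_trans jk) //= !mulr0 !addr0.
- by case: eqP => _; rewrite /= ?mulr0 ?mulr1 ?add0r ?addr0.
- by rewrite ltn_eqF //= mulr1 mulr0 addr0 addrC subrK.
Qed.

Lemma dot_hard_pointS k (v : V) : (k < N)%N -> dot v (hard_point k.+1)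
  = dot v (hard_point k) + (sigma k - rho k) * v 0 (inord k)
    + rho k.+1 * v 0 (inord k.+1).
Proof. by move=> kN; rewrite hard_pointS // !dotDr !dotZr !dot_delta. Qed.

Lemma dot_hard_point k (v : V) : (k <= N)%N -> dot v (hard_point k)
  = \sum_(i < k) sigma i * v 0 (inord i) + rho k * v 0 (inord k).
Proof.
elim: k => [_|k IHk kN].
  have -> : hard_point 0 = rho 0 *: delta_mx 0 (inord 0).
    apply/rowP => j; rewrite !mxE /= -val_eqE /= inordK //.
    by case: eqP => _; rewrite ?mulr1 ?mulr0.
  by rewrite dotZr dot_delta big_ord0 add0r.
by rewrite dot_hard_pointS // IHk ?(ltnW kN) // big_ord_recr /=; ring.
Qed.

Lemma hard_centerE k : (k <= N)%N -> hard_center 0 (inord k) = theta k.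
Proof. by move=> kN; rewrite mxE inordK. Qed.

(** The relation [hs_theta_next] is designed to produce this decrement, which keeps later vertices
    out of the projection in [hard_zero_chain]. *)
Lemma dot_center_step k : (k < N)%N -> dot hard_center (hard_point k.+1)
  = dot hard_center (hard_point k) - q * (rho k * (rho k - sigma k)).
Proof.
move=> kN; rewrite dot_hard_pointS // !hard_centerE ?(ltnW kN) //.
rewrite (hs_theta_next H kN); ring.
Qed.

Lemma dot_center_le k j : (k <= j <= N)%N ->
  dot hard_center (hard_point j) <= dot hard_center (hard_point k).
Proof.
move=> /andP[]; elim: j => [|j IHj]; first by rewrite leqn0 => /eqP ->.
rewrite leq_eqVlt => /orP[/eqP -> //|kj] jN.
apply: le_trans (IHj kj (ltnW jN)); rewrite dot_center_step // gerDl oppr_le0.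
by rewrite !mulr_ge0 ?subr_ge0 ?(ltW q0) // ltW ?(hs_rho_gt0 H) ?(hs_sigma_lt H) // ltnW.
Qed.

Lemma hard_center_hull : conv_hull N hard_point hard_center.
Proof.
have e0 : 0 < 1 - eta by rewrite subr_gt0.
exists (fun i => if (i <= N)%N then nu i / (1 - eta) else 0); split.
- by move=> i; case: ifP => // iN; rewrite divr_ge0 ?(hs_nu_ge0 H) // ltW.
- transitivity (\sum_(i < N.+1) nu i / (1 - eta)).
    by apply: eq_bigr => i _; rewrite -ltnS ltn_ord.
  by rewrite -mulr_suml (hs_nu_sum H) divff ?gt_eqF.
apply/rowP => j; rewrite summxE mxE.
apply: (mulfI (lt0r_neq0 e0)); rewrite (hs_theta_comb H) -1?ltnS //.
transitivity (\sum_(i < N.+1) nu i * hard_point i 0 j); last first.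
  rewrite mulr_sumr; apply: eq_bigr => i _; rewrite [in RHS]mxE -[(i <= N)%N]ltnS ltn_ord.
  by move: (hard_point i 0 j) => h; field; rewrite gt_eqF.
transitivity (\sum_(0 <= i < N.+1) nu i *
  (if (j < i)%N then sigma j else if j == i :> nat then rho i else 0)); last first.
  by rewrite big_mkord; apply: eq_bigr => i _; rewrite mxE.
rewrite (big_cat_nat (leq0n j)) /=; last by rewrite ltnW.
rewrite [X in _ = X + _]big_nat [X in _ = X + _]big1 ?add0r; last first.
  by move=> i ij; rewrite ltnNge (ltnW ij) /= gtn_eqF // mulr0.
rewrite [RHS]big_ltn // ltnn eqxx; congr (_ + _).
rewrite mulr_sumr; apply: eq_big_nat => i /andP[ji _].
by rewrite ji mulrC.
Qed.

(** Only the vertices beyond [k] need testing. Passing from vertex [k] to such a vertex, the center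
    lowers the scalar product by at least [rho k * (rho k - sigma k)], while [p], whose coordinate
    [k] is [l k * rho k], raises it by [l k] times that amount, and [l k <= 1]. *)
Lemma hard_zero_chain k (w p : V) : (k <= N)%N ->
  (forall j : 'I_N.+1, (k <= j)%N -> w 0 j = 0) ->
  is_projection k hard_point (q^-1 *: hard_center + w) p ->
  is_projection N hard_point (q^-1 *: hard_center + w) p /\
  (forall j : 'I_N.+1, (k < j)%N -> p 0 j = 0).
Proof.
move=> kN w0 [[l [l0 l1 pE]] Hp].
have p_gt (j : 'I_N.+1) : (k < j)%N -> p 0 j = 0.
  move=> kj; rewrite pE summxE big1 // => i _.
  by rewrite mxE hard_point_gt ?mulr0 // (leq_trans _ kj).
split => //; split.
  exists (fun i => if (i <= k)%N then l i else 0); split.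
  - by move=> i; case: ifP.
  - rewrite -l1 -(big_mkord xpredT (fun i => if (i <= k)%N then l i else 0)).
    rewrite -(big_mkord xpredT l) (big_cat_nat (leq0n k.+1)) //=.
    rewrite [X in _ + X]big_nat [X in _ + X]big1 ?addr0.
      by apply: eq_big_nat => i /andP[_]; rewrite ltnS => ->.
    by move=> i /andP[ki _]; rewrite leqNgt ki.
  rewrite pE -(big_mkord xpredT (fun i => l i *: hard_point i)).
  rewrite -(big_mkord xpredT
    (fun i => (if (i <= k)%N then l i else 0) *: hard_point i)).
  rewrite [RHS](big_cat_nat (leq0n k.+1)) //=.
  rewrite [X in _ + X]big_nat [X in _ + X]big1 ?addr0.
    by apply: eq_big_nat => i /andP[_]; rewrite ltnS => ->.
  by move=> i /andP[ki _]; rewrite leqNgt ki scale0r.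
move=> j jN; have [jk|kj] := leqP j k; first exact: Hp.
have kN' : (k < N)%N by apply: leq_trans jN.
pose y := q^-1 *: hard_center + w.
have pk : p 0 (inord k) = l k * rho k.
  rewrite pE summxE big_ord_recr big1 /= => [|i _]; last first.
    by rewrite mxE hard_point_gt ?mulr0 // inordK.
  by rewrite add0r !mxE inordK // ltnn eqxx.
have lk1 : l k <= 1.
  by rewrite -l1 big_ord_recr /= lerDr sumr_ge0.
have wj i : (k <= i <= N)%N -> dot w (hard_point i) = dot w (hard_point k).
  case/andP; elim: i => [|i IHi]; first by rewrite leqn0 => /eqP ->.
  rewrite leq_eqVlt => /orP[/eqP -> //|ki] iN.
  rewrite dot_hard_pointS // IHi ?(ltnW iN) // !w0 ?inordK ?ltnS ?(ltnW iN) //.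
    by rewrite !mulr0 !addr0.
  exact: ltnW.
have pj i : (k < i <= N)%N -> dot p (hard_point i)
    = dot p (hard_point k) + (sigma k - rho k) * (l k * rho k).
  case/andP; elim: i => // i IHi; rewrite ltnS leq_eqVlt => /orP[/eqP <- iN|ki iN].
    by rewrite dot_hard_pointS // pk p_gt ?mulr0 ?addr0 // inordK.
  rewrite dot_hard_pointS // IHi ?(ltnW iN) // !p_gt ?inordK ?ltnS ?(ltnW iN) //.
    by rewrite !mulr0 !addr0.
  exact: ltnW.
have Tj : dot hard_center (hard_point j) <= dot hard_center (hard_point k)
    - q * (rho k * (rho k - sigma k)).
  by rewrite -dot_center_step // dot_center_le // kj.
have Hk := Hp k (leqnn k).
have gap0 : 0 <= rho k * (rho k - sigma k) * (1 - l k).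
  rewrite !mulr_ge0 ?subr_ge0 // ltW ?(hs_rho_gt0 H) //.
  exact: (hs_sigma_lt H).
have Tj' : q^-1 * dot hard_center (hard_point j)
    <= q^-1 * dot hard_center (hard_point k) - rho k * (rho k - sigma k).
  by rewrite -(ler_pM2l q0) mulrBr !mulVKf ?gt_eqF.
pose v := q^-1 *: hard_center + w - p.
have vE x : dot v x = q^-1 * dot hard_center x + dot w x - dot p x.
  by rewrite /v !dotDl dotNl dotZl.
rewrite -/v in Hk *; clearbody v.
have -> : dot (hard_point j - p) v
    = dot (hard_point k - p) v + (dot v (hard_point j) - dot v (hard_point k)).
  by rewrite !dotDl !dotNl !(dotC v); ring.
rewrite -[leRHS]addr0 lerD // !vE wj ?(ltnW kj) // pj ?kj //.
move: Tj' gap0; move: (dot hard_center _) (dot hard_center _) (q^-1).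
by move=> Tk Tj0 iq; lra.
Qed.

(** * Values of the worst-case function at the start, at the minimizer and at the output *)

Section Values.
Variables (d : nat) (L : R) (E : 'M[R]_(N.+1, d)).
Hypothesis L0 : 0 < L.

(** Normalizes the minimum value to [0], see [hard_function_root]. *)
Definition hard_offset : R := - ((1 - q) / (2 * q) * dot hard_center hard_center).

Definition hard_function : 'rV[R]_d -> R :=
  hull_function N hard_point q L hard_offset (q^-1 *: hard_center) E.

Definition hard_gradient : 'rV[R]_d -> 'rV[R]_d :=
  hull_gradient N hard_point q L (q^-1 *: hard_center) E.

Definition hard_level : R := L * (1 - q) / (2 * q).

Definition hard_gap : R :=
  2 * rho 0%N * theta 0%N - q * rho 0%N ^+ 2 - \sum_(i < N.+1) theta i ^+ 2.

Lemma dot_hard_center : dot hard_center hard_center = \sum_(i < N.+1) theta i ^+ 2.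
Proof. by apply: eq_bigr => i _; rewrite mxE expr2. Qed.

Lemma projection_0 :
  projection N hard_point (q^-1 *: hard_center) = hard_point 0.
Proof.
apply: projection_eq; rewrite -[_ *: _]addr0.
suff P0 : is_projection 0 hard_point (q^-1 *: hard_center + 0) (hard_point 0).
  by apply: (proj1 (hard_zero_chain (leq0n N) _ P0)) => j _; rewrite mxE.
split; last by move=> i; rewrite leqn0 => /eqP ->; rewrite subrr dot0l.
by exists (fun=> 1); split=> [//||]; rewrite big_ord1 ?scale1r.
Qed.

Lemma hard_point_sqr i : (i <= N)%N -> dot (hard_point i) (hard_point i)
  = \sum_(j < i) sigma j ^+ 2 + rho i ^+ 2.
Proof.
move=> iN; rewrite dot_hard_point //; congr (_ + _).
  apply: eq_bigr => j _; have ji := ltn_ord j.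
  by rewrite mxE inordK ?ji ?expr2 // ltnS ltnW // (leq_trans ji).
by rewrite mxE inordK ?ltnS // ltnn eqxx expr2.
Qed.

Lemma hard_function0 : hard_function 0 = hard_level * hard_gap.
Proof.
rewrite /hard_function /hull_function mul0mx addr0 /hull_envelope projection_0.
rewrite dotZl dot_hard_point // big_ord0 add0r hard_centerE // hard_point_sqr //.
rewrite big_ord0 add0r dot0l /hard_offset dot_hard_center /hard_level /hard_gap.
by field; rewrite gt_eqF.
Qed.

Hypothesis EE : E *m E^T = 1%:M.

Let qb0 : 0 < 1 - q. Proof. by rewrite subr_gt0. Qed.

(** Testing the envelope at the center, a point of the hull, leaves a perfect square after [bessel];
    it vanishes at the minimizer. *)
Lemma hard_function_ge w :
  L * q / 2 * dot (w *m E^T + ((1 - q) / q) *: hard_center)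
                  (w *m E^T + ((1 - q) / q) *: hard_center) <= hard_function w.
Proof.
have := hull_envelope_ge (q^-1 *: hard_center + w *m E^T) hard_center_hull.
rewrite /hard_function /hull_function /hard_offset => Henv.
have Hb := bessel EE w.
rewrite -[L * q / 2]mulrA -[L * _ * _]mulrA ler_pM2l //.
rewrite -(ler_pM2l qb0) in Henv.
apply: le_trans (lerD (lexx _) Henv); apply: le_trans (_ : - ((1 - q) / (2 * q) *
  dot hard_center hard_center) + q / 2 * dot (w *m E^T) (w *m E^T)
  + (1 - q) * (dot (q^-1 *: hard_center + w *m E^T) hard_center
               - dot hard_center hard_center / 2) <= _).
  rewrite !dotE (dotC hard_center (w *m _)).
  move: (dot hard_center _) (dot _ hard_center) (dot _ _) => cc wc ww.
  by rewrite le_eqVlt; apply/orP; left; apply/eqP; field; rewrite gt_eqF.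
by rewrite lerD2r lerD2l ler_wpM2l // divr_ge0 // ltW.
Qed.

Lemma hard_function_ge0 w : 0 <= hard_function w.
Proof.
by apply: le_trans (hard_function_ge w); rewrite mulr_ge0 ?dot_ge0 // divr_ge0 // mulr_ge0 ?ltW.
Qed.

Lemma hard_function_root :
  hard_function (- ((1 - q) / q) *: (hard_center *m E)) = 0.
Proof.
apply/eqP; rewrite eq_le hard_function_ge0 andbT.
rewrite /hard_function /hull_function -scalemxAl -mulmxA EE mulmx1.
rewrite dotZl dotZr dot_isometry // -scalerDl.
have -> : q^-1 + - ((1 - q) / q) = 1 by field; rewrite gt_eqF.
rewrite scale1r.
have : hull_envelope N hard_point hard_center <= dot hard_center hard_center / 2.
  rewrite /hull_envelope; move: (projection _ _ _) => p.
  by have := dot_ge0 (hard_center - p); rewrite !dotE (dotC p); lra.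
rewrite pmulr_rle0 // => Henv; rewrite -(ler_pM2l qb0) in Henv.
apply: le_trans (lerD (lexx _) Henv) _.
rewrite le_eqVlt; apply/orP; left; apply/eqP.
by rewrite /hard_offset; field; rewrite gt_eqF.
Qed.

Lemma hard_function0_gt0 : 0 < hard_function 0.
Proof.
apply: lt_le_trans (hard_function_ge 0); rewrite mul0mx add0r dotZl dotZr.
have cc : 0 < dot hard_center hard_center.
  rewrite dot_hard_center big_ord_recl ltr_pwDl ?exprn_gt0 ?(hs_theta_gt0 H) //.
  by apply: sumr_ge0 => i _; rewrite sqr_ge0.
by rewrite !mulr_gt0 ?invr_gt0.
Qed.

(** Testing the envelope at the last vertex leaves a quadratic in the first [N] coordinates. Its
    minimum, where each coordinate [x] satisfies [q * x + (1 - q) * sigma i = 0], is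
    [eta * hard_function 0] by [hs_ratio]. *)
Lemma hard_function_lower_bound w : (w *m E^T) 0 ord_max = 0 ->
  eta * hard_function 0 <= hard_function w.
Proof.
move=> wN; rewrite hard_function0 mulrCA (hs_ratio H).
have hullN : conv_hull N hard_point (hard_point N).
  exists (fun i => (i == N)%:R); split=> [i||]; first exact: ler0n.
    by rewrite big_ord_recr /= eqxx big1 ?add0r // => i _; rewrite ltn_eqF.
  rewrite big_ord_recr /= eqxx scale1r big1 ?add0r // => i _.
  by rewrite ltn_eqF // scale0r.
have := hull_envelope_ge (q^-1 *: hard_center + w *m E^T) hullN.
rewrite /hard_function /hull_function /hard_offset dot_hard_center => Henv.
have Hb := bessel EE w.
move: Henv; rewrite dotDl dotZl hard_point_sqr //.
rewrite (dot_hard_point hard_center) // (dot_hard_point (w *m E^T)) //.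
have -> : (inord N : 'I_N.+1) = ord_max by apply: val_inj; rewrite /= inordK.
rewrite wN mulr0 addr0 mxE.
have -> : \sum_(i < N) sigma i * hard_center 0 (inord i)
    = \sum_(i < N) sigma i * theta i.
  by apply: eq_bigr => i _; rewrite hard_centerE // ltnW.
move: Hb; rewrite {1}/dot big_ord_recr /= wN mulr0 addr0.
set W2 := \sum_(i < N) _; set SW := \sum_(i < N) sigma i * (w *m E^T) _ _.
move=> Hb Henv.
have Hsq : 0 <= q / 2 * W2 + (1 - q) * SW
    + (1 - q) ^+ 2 / (2 * q) * \sum_(i < N) sigma i ^+ 2.
  rewrite !mulr_sumr -!big_split; apply: sumr_ge0 => i _ /=.
  have -> : widen_ord (leqnSn N) i = inord i.
    by apply: val_inj; rewrite /= inordK // ltnS ltnW.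
  move: ((w *m E^T) 0 (inord i)) (sigma i) => x s.
  have -> : q / 2 * (x * x) + (1 - q) * (s * x) + (1 - q) ^+ 2 / (2 * q) * s ^+ 2
    = (q * x + (1 - q) * s) ^+ 2 / (2 * q) by field; rewrite gt_eqF.
  by rewrite divr_ge0 ?sqr_ge0 // mulr_ge0 // ltW.
rewrite /hard_level -[L * _ / _]mulrA -[L * _ * _]mulrA ler_pM2l //.
have Hb' : q / 2 * W2 <= q / 2 * dot w w by rewrite ler_wpM2l // divr_ge0 // ltW.
rewrite -(ler_pM2l qb0) in Henv.
apply: le_trans (lerD (lerD (lexx _) Hb') Henv).
rewrite -subr_ge0; move: Hsq; clear Hb Henv Hb'; clearbody W2 SW.
move: (\sum_(i < N) sigma i * theta i) (\sum_(i < N) sigma i ^+ 2)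
  (\sum_(i < N.+1) theta i ^+ 2) => st s2 t2.
move/le_trans; apply; rewrite le_eqVlt; apply/orP; left; apply/eqP.
by field; rewrite gt_eqF.
Qed.

End Values.

End HardInstance.

(** * The resisting oracle *)

Lemma exists_unit_orthogonal (R : realType) (n d : nat) (u : 'I_n -> 'rV[R]_d) :
  (n < d)%N -> exists v : 'rV[R]_d, dot v v = 1 /\ forall i, dot (u i) v = 0.
Proof.
move=> nd; pose A := \matrix_(i < n) u i.
have ker0 : kermx A^T != 0.
  rewrite -mxrank_eq0 mxrank_ker -lt0n subn_gt0.
  by apply: leq_ltn_trans nd; rewrite rank_leq_col.
have [k vk] : exists k, row k (kermx A^T) != 0.
  apply/existsP; apply: contraR ker0 => /existsPn K0.
  apply/eqP/row_matrixP => i; rewrite row0.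
  by apply/eqP; have := K0 i; rewrite negbK.
pose v := row k (kermx A^T).
have vA : v *m A^T = 0 by apply/sub_kermxP; exact: row_sub.
have v_gt0 : 0 < dot v v.
  by rewrite lt0r dot_ge0 andbT; apply: contra vk => /eqP/dot_eq0/eqP.
exists ((Num.sqrt (dot v v))^-1 *: v); split=> [|i].
  rewrite dotZl dotZr mulrA -expr2 exprVn sqr_sqrtr ?dot_ge0 //.
  by rewrite mulVf // gt_eqF.
suff vi : dot v (u i) = 0 by rewrite dotZr dotC vi mulr0.
transitivity ((v *m A^T) 0 i); last by rewrite vA mxE.
by rewrite [RHS]mxE; apply: eq_bigr => j _; rewrite [A^T _ _]mxE [A _ _]mxE.
Qed.

(** Peels off the last call, whereas the definition peels off the first; once the method stops, the
    history stays fixed. *)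
Lemma extend_historyS (R : realType) (d : nat) (M : @method R d)
    (O : 'rV[R]_d -> @answer R d) x0 n h :
  extend_history M O x0 n.+1 h =
  let h' := extend_history M O x0 n h in
  if next_query M x0 h' is Some y then rcons h' (O y) else h'.
Proof.
elim: n h => [//|n IHn] h.
transitivity (if next_query M x0 h is Some y
  then extend_history M O x0 n.+1 (rcons h (O y)) else h); first by [].
rewrite [extend_history M O x0 n.+1 h]/=.
by case E : (next_query M x0 h) => [y|]; [exact: IHn | rewrite /= E].
Qed.

Section ResistingOracle.
Context {R : realType} {d : nat}.
Local Notation E := 'rV[R]_d.
Variables (N : nat) (q eta : R) (nu rho sigma theta : nat -> R).
Hypothesis H : hard_sequences N q eta nu rho sigma theta.
Hypotheses (N1 : (1 <= N)%N) (q0 : 0 < q) (q1 : q < 1) (eta1 : eta < 1).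
Variables (L : R) (M : @method R d).
Hypotheses (L0 : 0 < L) (hd : (2 * N + 1 <= d)%N).

Definition frame (e : nat -> E) : 'M[R]_(N.+1, d) := \matrix_(i < N.+1) e i.

Definition frame_answer e (w : E) : @answer R d :=
  (hard_function q rho sigma theta L (frame e) w,
   hard_gradient q rho sigma theta L (frame e) w).

Lemma mul_frame_tr e (w : E) i : (w *m (frame e)^T) 0 i = dot w (e i).
Proof. by rewrite mxE; apply: eq_bigr => j _; rewrite !mxE. Qed.

(* A query orthogonal to the directions [k, .., N] reveals the direction [k], and
   none beyond it. *)
Lemma frame_answer_eq k e e' (w : E) : (k <= N)%N ->
  (forall j, (j <= k)%N -> e j = e' j) ->
  (forall j, (k <= j <= N)%N -> dot w (e j) = 0 /\ dot w (e' j) = 0) ->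
  frame_answer e w = frame_answer e' w.
Proof.
move=> kN ee' w0.
have wE : w *m (frame e)^T = w *m (frame e')^T.
  apply/rowP => i; rewrite !mul_frame_tr.
  have [ik|ki] := leqP i k; first by rewrite ee'.
  by have [-> ->] := w0 i (introT andP (conj (ltnW ki) (ltn_ord i))).
rewrite /frame_answer /hard_function /hard_gradient /hull_function /hull_gradient wE.
congr (_, L *: (_ + _ *: _)).
have w0' (j : 'I_N.+1) : (k <= j)%N -> (w *m (frame e')^T) 0 j = 0.
  move=> kj; rewrite mul_frame_tr.
  by have [] := w0 j (introT andP (conj kj (ltn_ord j))).
have [p Hp] := projection_exists k (hard_point N rho sigma)
  (q^-1 *: hard_center N theta + w *m (frame e')^T).
have [HpN p0] := hard_zero_chain H q0 kN w0' Hp.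
rewrite (projection_eq HpN) !mulmx_sum_row; apply: eq_bigr => i _.
have [ik|ki] := leqP i k; first by rewrite !rowK ee'.
by rewrite p0 // !scale0r.
Qed.

(** Contains up to [k.+1] answers: the one at the origin, which is the starting point, and [k]
    further calls. *)
Definition frame_history e k : seq (@answer R d) :=
  extend_history M (frame_answer e) 0 k [:: frame_answer e 0].

(* The query of index [N] is the output; a method that stops early gets the dummy
   query [0]. *)
Definition frame_query e k : E :=
  if k is k'.+1 then
    if k == N then output M 0 (frame_history e k')
    else if next_query M 0 (frame_history e k') is Some y then y else 0
  else 0.

Lemma frame_history_eq e e' k : (k < N)%N ->
  (forall i, (i <= k)%N ->
    frame_answer e (frame_query e i) = frame_answer e' (frame_query e i)) ->
  frame_history e k = frame_history e' k.
Proof.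
move=> kN; elim: k kN => [_ /(_ 0%N (leqnn _)) /= H0|k IHk kN Hk].
  by rewrite /frame_history /= H0.
have IH := IHk (ltnW kN) (fun i ik => Hk i (leqW ik)).
have := Hk k.+1 (leqnn _); rewrite /frame_query (ltn_eqF kN).
rewrite /frame_history !extend_historyS -!/(frame_history _ k) -IH /=.
by case: (next_query M 0 (frame_history e k)) => [y ->|_].
Qed.

(** Directions are fixed one at a time, those beyond [k] being [0]. The first [k.+1] directions
    already determine the queries up to index [k.+1], so the next direction can be chosen orthogonal
    to all of them. *)
Lemma resisting_frame k : (k <= N)%N -> exists e : nat -> E,
  [/\ forall i j, (i <= k)%N -> (j <= k)%N -> dot (e i) (e j) = (i == j)%:R,
      forall j, (k < j)%N -> e j = 0
    & forall i j, (i <= k)%N -> (i <= j)%N -> dot (frame_query e i) (e j) = 0].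
Proof.
elim: k => [_|k IHk kN].
  have [v [vv _]] := @exists_unit_orthogonal R 0 d (fun=> 0) (ltac:(lia)).
  exists (fun j => if j == 0%N then v else 0); split.
  - by move=> i j; rewrite !leqn0 => /eqP -> /eqP ->.
  - by case.
  - by move=> i j; rewrite leqn0 => /eqP -> _; rewrite dot0l.
have [e [ee e0 qe]] := IHk (ltnW kN).
(* The directions [0] to [k] and the queries [1] to [k.+1]; query [0] is the zero vector. As
   [k < N], these are at most [2 * N] vectors, fewer than [d]. *)
pose u (i : 'I_(2 * k.+1)) : E :=
  if (i < k.+1)%N then e i else frame_query e (i - k).
have [v [vv uv]] := exists_unit_orthogonal u (ltac:(lia)).
have ev i : (i <= k)%N -> dot (e i) v = 0.
  move=> ik; have i2 : (i < 2 * k.+1)%N by lia.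
  by have := uv (Ordinal i2); rewrite /u /= ltnS ik.
have qv i : (i <= k.+1)%N -> dot (frame_query e i) v = 0.
  case: i => [_|i ik]; first by rewrite dot0l.
  have i2 : (i.+1 + k < 2 * k.+1)%N by lia.
  have := uv (Ordinal i2); rewrite /u /= addnK ifF //.
  by apply/negbTE; rewrite -leqNgt addSn ltnS leq_addl.
pose e' j := if j == k.+1 then v else e j.
have e'E j : (j <= k)%N -> e' j = e j by move=> jk; rewrite /e' ltn_eqF.
(* Inserting [v] as direction [k.+1] does not alter the answers given so far, hence not the queries
   either. *)
have ans i : (i <= k)%N ->
    frame_answer e (frame_query e i) = frame_answer e' (frame_query e i).
  move=> ik; apply: (@frame_answer_eq i) => [|j ji|j /andP[ij jN]].
  - by apply: leq_trans ik (ltnW kN).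
  - by rewrite e'E // (leq_trans ji).
  - split; first exact: qe.
    by rewrite /e'; case: eqP => _; [apply/qv/leqW | exact: qe].
have hist i : (i <= k)%N -> frame_history e i = frame_history e' i.
  move=> ik; apply: frame_history_eq => [|j ji]; first exact: leq_ltn_trans kN.
  by apply: ans; apply: leq_trans ik.
have query i : (i <= k.+1)%N -> frame_query e' i = frame_query e i.
  by case: i => // i ik; rewrite /frame_query hist.
exists e'; split.
- move=> i j; rewrite leq_eqVlt => /orP[/eqP ->|ik];
    rewrite leq_eqVlt => /orP[/eqP ->|jk].
  + by rewrite eqxx /e' eqxx.
  + by rewrite gtn_eqF // /e' eqxx ltn_eqF // dotC ev.
  + by rewrite ltn_eqF // /e' eqxx ltn_eqF // ev.
  + by rewrite !e'E // ee.
- by move=> j kj; rewrite /e' gtn_eqF // e0 // ltnW.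
- move=> i j ik ij; rewrite query // /e'; case: eqP => [_|/eqP jk]; first exact: qv.
  have [jk'|kj] := leqP j k; last by rewrite e0 // dot0r.
  by rewrite qe // (leq_trans ij).
Qed.

Lemma resisting_instance : exists f : E -> R,
  [/\ smooth_strongly_convex (q * L) L f,
      attains_min f, min_value f = 0,
      f 0 = hard_level q L * hard_gap N q rho theta
    & eta * f 0 <= f (run N M (oracle f) 0)].
Proof.
have [e [ee e0 qe]] := resisting_frame (leqnn N).
have EE : frame e *m (frame e)^T = 1%:M.
  apply/matrixP => i j; rewrite !mxE -val_eqE /=.
  have -> : (i == j :> nat)%:R = dot (e i) (e j) by rewrite ee // -ltnS.
  by apply: eq_bigr => k _; rewrite !mxE.
pose f := hard_function q rho sigma theta L (frame e).
have fge0 := hard_function_ge0 H q0 q1 eta1 L0 EE.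
have froot := hard_function_root H q0 q1 eta1 L0 EE.
pose xs : E := - ((1 - q) / q) *: (hard_center N theta *m frame e).
have amin : attains_min f by exists xs => x; rewrite /f froot; exact: fge0.
exists f; split.
- exact: hull_function_smooth_strongly_convex.
- exact: amin.
- by rewrite (min_value_eq (x := xs)) // => x; rewrite /f froot; exact: fge0.
- by rewrite /f (hard_function0 H).
have Of w : oracle f w = frame_answer e w.
  rewrite /oracle /frame_answer; congr (_, _).
  by have [_ ->] := gradient_hull_function N (hard_point N rho sigma)
    (hard_offset N q theta) (q^-1 *: hard_center N theta) EE q0 q1 L0 w.
have -> : run N M (oracle f) 0 = frame_query e N.
  rewrite (funext Of) /run /history /frame_query.
  by case: (N) N1 => // n _; rewrite eqxx.
(* The output counts as query [N], so it is orthogonal to [e N], the direction of the last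
   coordinate. *)
apply: (hard_function_lower_bound H q0 q1 L0 EE); rewrite mul_frame_tr.
by rewrite qe // leqnn.
Qed.

End ResistingOracle.

(** * Minimax risk *)

Section MinimaxRisk.
Context {R : realType}.
Variables (N : nat) (q : R).

(** Read off from the value at the origin of the worst-case function with [L = 1] and the identity
    frame. *)
Lemma hard_gap_gt0 (eta : R) (nu rho sigma theta : nat -> R) :
  hard_sequences N q eta nu rho sigma theta -> 0 < q -> q < 1 -> eta < 1 ->
  0 < hard_gap N q rho theta.
Proof.
move=> H q0 q1 eta1.
have EE : 1%:M *m (1%:M : 'M[R]_(N.+1))^T = 1%:M by rewrite trmx1 mulmx1.
have := hard_function0_gt0 H q0 q1 eta1 ltr01 EE.
rewrite (hard_function0 H q0) pmulr_rgt0 // /hard_level mul1r.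
by rewrite divr_gt0 ?subr_gt0 ?mulr_gt0.
Qed.

Lemma hard_gap_scale (s : R) (rho theta : nat -> R) :
  hard_gap N q (fun k => s * rho k) (fun k => s * theta k)
  = s ^+ 2 * hard_gap N q rho theta.
Proof.
rewrite /hard_gap.
have -> : \sum_(i < N.+1) (s * theta i) ^+ 2
    = s ^+ 2 * \sum_(i < N.+1) theta i ^+ 2.
  by rewrite mulr_sumr; apply: eq_bigr => i _; rewrite exprMn.
by ring.
Qed.

Lemma minimax_risk_lower_bound (eta : R) (a b c : nat -> R) (d : nat) (L Rf : R) :
  risk_scheme N q eta a b c -> (2 * N + 1 <= d)%N -> 0 < L -> 0 < Rf ->
  ((eta * Rf)%:E <= minimax_risk N (function_value_class d (q * L) L Rf))%E.
Proof.
move=> S hd L0 Rf0.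
have [N1 q0 q1 eta0 eta1 *] := S.
have [nu [rho [sigma [theta HS]]]] : exists nu rho sigma theta,
    hard_sequences N q eta nu rho sigma theta.
  by do 4 eexists; exact: hard_sequences_of_scheme S.
have gap0 := hard_gap_gt0 HS q0 q1 eta1.
have level0 : 0 < hard_level q L.
  by apply: divr_gt0; apply: mulr_gt0; rewrite ?subr_gt0.
(* The gap scales with [s ^+ 2]; this factor makes the initial value exactly [Rf]. *)
pose s := Num.sqrt (Rf / (hard_level q L * hard_gap N q rho theta)).
have pos : 0 < Rf / (hard_level q L * hard_gap N q rho theta).
  by apply: divr_gt0 => //; exact: mulr_gt0.
have s0 : 0 < s by rewrite sqrtr_gt0.
have HS' := hard_sequences_scale s0 HS.
apply: le_ereal_inf_tmp => _ [M _ <-].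
have [f [fP fmin min0 f0 fN]] := resisting_instance HS' N1 q0 q1 eta1 M L0 hd.
have f0E : f 0 = Rf.
  rewrite f0 hard_gap_scale (sqr_sqrtr (ltW pos)).
  by field; rewrite !gt_eqF.
apply: le_ereal_sup_tmp; exists (gap N M (f, 0))%:E.
  by exists (f, 0) => //; split=> //=; rewrite min0 subr0 f0E.
by rewrite lee_fin /gap [(f, 0).1]/= [(f, 0).2]/= min0 subr0 -f0E.
Qed.

Lemma risk_coefficient_minimax (eta : R) (d : nat) (L Rf : R) :
  (1 <= N)%N -> 0 < q < 1 ->
  is_risk_coefficient N q (function_weight R) eta ->
  (2 * N + 1 <= d)%N -> 0 < L -> 0 < Rf ->
  minimax_risk N (function_value_class d (q * L) L Rf) = (eta * Rf)%:E.
Proof.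
move=> N1 q01 /(risk_coefficient_scheme N1 q01) S hd L0 Rf0.
apply/eqP; rewrite eq_le (minimax_risk_upper_bound S L0) /=.
exact: minimax_risk_lower_bound S hd L0 Rf0.
Qed.

Lemma item_f_risk_coefficient (U : R) (alpha beta : nat -> R) :
  (1 <= N)%N -> 0 < q < 1 -> item_f_data N q U alpha beta ->
  is_risk_coefficient N q (function_weight R) (U ^- 2).
Proof.
move=> N1 /andP[q0 q1] [U1 aN bN coord bnd a1_gt0 alt aNU b1_gt0].
have U0 : 0 < U by apply: lt_trans U1.
have Un0 : U != 0 by rewrite gt_eqF.
have qb0 : 0 < 1 - q by rewrite subr_gt0.
have U2 : 0 < U ^+ 2 - 1 by rewrite subr_gt0 exprn_egt1.
pose r := Num.sqrt (weight_r2 q (function_weight R) (U ^- 2)).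
have r2E : weight_r2 q (function_weight R) (U ^- 2) = q * ((U ^+ 2 - 1) / U ^+ 2).
  by rewrite /weight_r2 /=; field.
have rE : r = Num.sqrt q * Num.sqrt (U ^+ 2 - 1) / U.
  rewrite /r r2E sqrtrM ?(ltW q0) // sqrtrM ?(ltW U2) // sqrtrV ?sqr_ge0 //.
  by rewrite sqrtr_sqr gtr0_norm // mulrA.
have alpha_mono k j : (1 <= k)%N -> (k <= j <= N)%N -> alpha k <= alpha j.
  move=> k1 /andP[]; elim: j => [|j IHj]; first by rewrite leqn0 => /eqP ->.
  rewrite leq_eqVlt => /orP[/eqP -> //|kj] jN.
  apply: le_trans (IHj kj (ltnW jN)) (ltW (alt _ _)).
  by rewrite jN andbT (leq_trans k1).
have alpha_gt0 k : (1 <= k <= N)%N -> 0 < alpha k.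
  by case/andP=> k1 kN; apply: lt_le_trans (alpha_mono 1%N k _ _) => //; rewrite k1.
have alpha_ltU k : (1 <= k <= N)%N -> alpha k < U.
  case/andP=> k1 kN; apply: le_lt_trans (alpha_mono k N _ _) aNU => //.
  by rewrite kN leqnn.
(* The ITEM-f sine is therefore [sqrt q] times the root of the backward step, which explains the
   factor [sqrt q] between [b] and [beta / U]. *)
have radE k : (1 <= k <= N)%N -> 1 - (1 - q * alpha k / U) ^+ 2
    = q * bwd_radicand q (1 - alpha k / U).
  by move=> kN; rewrite /bwd_radicand; field.
have rad_ge0 k : (1 <= k <= N)%N -> 0 <= bwd_radicand q (1 - alpha k / U).
  move=> kN; have ak := alpha_gt0 _ kN; have akU := alpha_ltU _ kN.
  have a01 : 0 < alpha k / U < 1 by rewrite divr_gt0 //= ltr_pdivrMr // mul1r.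
  rewrite /bwd_radicand subKr mulr_ge0 ?(ltW (proj1 (andP a01))) //.
  have : 0 <= q * (1 - alpha k / U) by rewrite mulr_ge0 ?(ltW q0) // subr_ge0 ltW //; case/andP: a01.
  by move: qb0; lra.
have pairE k : (1 <= k <= N)%N -> bwd_a N q r k = 1 - alpha k / U /\
    bwd_b N q r k = Num.sqrt q * beta k / U.
  move: k; apply: backward_ind => [|k kN].
    rewrite /bwd_a /bwd_b /bwd_pair subnn /= aN bN rE; split; first by field.
    by ring.
  have /andP[k1 ltkN] := kN; have k1N : (1 <= k.+1 <= N)%N by rewrite ltkN.
  move=> [IHa IHb].
  have aS : bwd_pair N q r k = bwd_step q (bwd_pair N q r k.+1).
    by rewrite /bwd_pair -(subnSK ltkN).
  have [] := coord k kN.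
  have -> : Num.sqrt (1 - (1 - q * alpha k.+1 / U) ^+ 2)
      = Num.sqrt q * Num.sqrt (bwd_radicand q (1 - alpha k.+1 / U)).
    rewrite -sqrtrM ?(ltW q0) //; congr Num.sqrt; exact: radE.
  have q2 : Num.sqrt q * Num.sqrt q = q by rewrite -expr2 sqr_sqrtr ?ltW.
  rewrite /bwd_a /bwd_b aS /bwd_step -/(bwd_a N q r k.+1) -/(bwd_b N q r k.+1).
  rewrite IHa IHb /=; move: (Num.sqrt (bwd_radicand _ _)) => C -> ->.
  split; first by field.
  transitivity (- (Num.sqrt q * Num.sqrt q) * C * (1 - alpha k.+1 / U)
    + (1 - q + q * (1 - alpha k.+1 / U)) * (Num.sqrt q * beta k.+1 / U)).
    by rewrite q2.
  by field.
have k1N : (1 <= 1 <= N)%N by [].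
have kNN : (1 <= N <= N)%N by rewrite N1 leqnn.
have [a1E b1E] := pairE _ k1N; have [aNE _] := pairE _ kNN.
have rN : bwd_a N q r N = r by rewrite /bwd_a /bwd_pair subnn.
have a_lt1 k : (1 <= k <= N)%N -> bwd_a N q r k < 1.
  by move=> kN; have [-> _] := pairE _ kN; rewrite gtrBl divr_gt0 // alpha_gt0.
have aN0 : 0 < bwd_a N q r N by rewrite aNE subr_gt0 ltr_pdivrMr // mul1r.
rewrite /is_risk_coefficient -/r; split.
- by rewrite invr_ge0 exprn_ge0 // ltW.
- by rewrite r2E mulr_gt0 // divr_gt0 // exprn_gt0.
- split; first by rewrite -{1 2}rN aN0 a_lt1.
  split=> //.
  + move=> k /andP[k2 kN].
    have kN' : (1 <= k <= N)%N by rewrite kN ltnW.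
    by have [-> _] := pairE _ kN'; exact: rad_ge0.
  + exact: a_lt1.
  + move=> k kN; have /andP[k1 ltkN] := kN.
    have kN' : (1 <= k <= N)%N by rewrite k1 ltnW.
    have [-> _] := pairE _ kN'; have [-> _] := pairE k.+1 ltkN.
    by rewrite ltrD2l ltrN2 ltr_pM2r ?invr_gt0 // alt.
  + by rewrite b1E divr_gt0 // mulr_gt0 // sqrtr_gt0.
rewrite a1E b1E /= add0r mulr1 bnd.
have -> : Num.sqrt (U ^- 2 / (1 - q)) = (U * Num.sqrt (1 - q))^-1.
  rewrite -invfM sqrtrV ?(mulr_ge0 (sqr_ge0 U) (ltW qb0)) //.
  by rewrite sqrtrM ?sqr_ge0 // sqrtr_sqr gtr0_norm.
rewrite sqrtrM ?(ltW qb0) // sqrtrV ?(ltW q0) //.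
by field; rewrite Un0 !gt_eqF ?sqrtr_gt0.
Qed.

End MinimaxRisk.

Theorem propositionB3 (R : realType) (N : nat) (q Upsilon : R)
    (alpha beta : nat -> R) :
  (1 <= N)%N -> 0 < q < 1 ->
  item_f_data N q Upsilon alpha beta ->
  unique (is_risk_coefficient N q (function_weight R)) (Upsilon ^- 2) /\
  forall (d : nat) (L mu Rf : R),
    (2 * N + 1 <= d)%N -> 0 < L -> mu = q * L -> 0 < Rf ->
    minimax_risk N (function_value_class d mu L Rf)
      = (Upsilon ^- 2 * Rf)%:E.
Proof.
move=> N1 q01 /(item_f_risk_coefficient N1 q01) riskU.
split; last by move=> d L _ Rf hd L0 -> Rf0; exact: risk_coefficient_minimax.
split=> // eta risk_eta.
(* Both coefficients equal the minimax risk of one and the same class, with [d = 2 * N + 1] and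
   [L = Rf = 1]. *)
have := risk_coefficient_minimax N1 q01 riskU (leqnn _) ltr01 ltr01.
rewrite (risk_coefficient_minimax N1 q01 risk_eta (leqnn _) ltr01 ltr01).
by rewrite !mulr1 => -[].
Qed.
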